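(* Let $\mathbb{K}$ be an uncountable algebraically closed field, let $A=\mathbb{K}[\![x_1,\dots,x_n]\!]$ with maximal ideal $\mathfrak{m}$. Let $X$ be an irreducible closed subvariety of $\operatorname{Spec}(A)$ and assume further that $X$ is not embedded in any hyperplane, i.e. $X\not\subset\operatorname{Spec}(A/\langle h\rangle)$ for every $h\in\mathfrak{m}-\mathfrak{m}^2$. Let $(h_i)_{i\ge1}$ be an infinite sequence in $\mathfrak{m}-\mathfrak{m}^2$, with $H_i=\operatorname{Spec}(A/\langle h_i\rangle)$, such that every $\Sigma_{X\cap H_i}$ has dimension $d$ and the multiplicity of $\Sigma_{X\cap H_i}$ tends to $\infty$ as $i\to\infty$. Then there exists $h\in\mathfrak{m}-\mathfrak{m}^2$, with $H=\operatorname{Spec}(A/\langle h\rangle)$, such that $\Sigma_{X\cap H}$ has dimension $\ge d+1$.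
   Context: A closed subvariety of $\operatorname{Spec}(A)$ is a reduced closed subscheme $X=\operatorname{Spec}(A/I(X))$. Intersections $X\cap H$ are scheme-theoretic, i.e. $X\cap H=\operatorname{Spec}(A/(I(X)+\langle h\rangle))$. Singular scheme: for a closed subscheme $Y\subset\operatorname{Spec}(A)$ with ideal $I(Y)=\langle f_1,\dots,f_k\rangle$ and an integer $\alpha$, $\Sigma^{\alpha}_Y:=\operatorname{Spec}\big(A/(I(Y)+J_{n-\alpha}(Y))\big)$, where $J_{n-\alpha}(Y)$ is the ideal generated by the $(n-\alpha)\times(n-\alpha)$ minors of the Jacobian matrix $(\partial f_i/\partial x_j)$ (independent of the choice of generators). If $Y$ is equidimensional of dimension $\alpha$ (all irreducible components have dimension $\alpha$), $\Sigma_Y:=\Sigma^{\alpha}_Y$. Here $X\cap H$ is equidimensional of dimension $\dim X-1$. The multiplicity of a closed subscheme $\operatorname{Spec}(R)$, with $R$ a quotient of $A$ of dimension $d$, is $e(R,\mathfrak{m})=\lim_{k\to\infty} d!\,\lambda(R/\mathfrak{m}^{k+1}R)/k^d$, where $\lambda$ denotes length. *)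

(* Defs.v *)
From HB Require Import structures.
From mathcomp Require Import all_boot all_order all_algebra.
(* The notations of mpoly clash with those of topology and normedtype. *)
From mathcomp Require Import -(notations) mpoly.
From mathcomp Require Import boolp classical_sets cardinality reals topology.
From mathcomp Require Import normedtype sequences.
Set Implicit Arguments.
Unset Strict Implicit.
Unset Printing Implicit Defensive.
Import Order.TTheory GRing.Theory Num.Theory numFieldNormedType.Exports.

Local Open Scope classical_set_scope.
Local Open Scope ring_scope.

(* K[[x_1, ..., x_n]], by coefficients indexed by monomials. *)
Record powser (n : nat) (K : comNzRingType) : Type :=
  PowSer { coefps : multinom n -> K }.

HB.instance Definition _ n K := gen_eqMixin (powser n K).
HB.instance Definition _ n K := gen_choiceMixin (powser n K).

Section PowerSeriesRing.
Context (n : nat) (K : comNzRingType).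
Local Notation mon := (multinom n).
Local Notation A := (powser n K).
Implicit Types (f g h : A) (m : mon).

Lemma powserP f g : (forall m, coefps f m = coefps g m) -> f = g.
Proof. by case: f g => [f] [g] /= /funext ->. Qed.

Definition powser0 : A := PowSer (fun=> 0).
Definition powser1 : A := PowSer (fun m => (m == mnm0)%:R).
Definition powser_opp f : A := PowSer (fun m => - coefps f m).
Definition powser_add f g : A := PowSer (fun m => coefps f m + coefps g m).

(* The bound on the degrees of the two monomials only makes the index type
   finite: [k.1 + k.2 = m] already forces it. *)
Definition powser_mul f g : A := PowSer (fun m =>
  \sum_(k : bmultinom n (mdeg m).+1 *
            bmultinom n (mdeg m).+1
        | m == mnm_add (bmnm k.1) (bmnm k.2))
     coefps f (bmnm k.1) * coefps g (bmnm k.2)).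

Definition trunc_ps (d : nat) f : mpoly n K :=
  \sum_(m : bmultinom n d)
     coefps f (bmnm m) *: mpolyX K (bmnm m).

Lemma coef_trunc_ps d f m : (mdeg m < d)%N ->
  mcoeff m (trunc_ps d f) = coefps f m.
Proof. exact: mcoeff_mpoly. Qed.

Lemma mcoeffM_eq (p q p' q' : mpoly n K) m :
    (forall k, (mdeg k <= mdeg m)%N ->
       mcoeff k p = mcoeff k p') ->
    (forall k, (mdeg k <= mdeg m)%N ->
       mcoeff k q = mcoeff k q') ->
  mcoeff m (p * q) = mcoeff m (p' * q').
Proof.
move=> pp qq; rewrite !mcoeffM; apply: eq_bigr => k _.
by rewrite pp ?qq // -ltnS bmdeg.
Qed.

Lemma coef_mul_ps d f g m : (mdeg m < d)%N ->
  coefps (powser_mul f g) m = mcoeff m (trunc_ps d f * trunc_ps d g).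
Proof.
move=> md; rewrite mcoeffM; apply: eq_bigr => k _.
by rewrite !coef_trunc_ps //; apply: leq_trans md; apply: bmdeg.
Qed.

Fact powser_addA : associative powser_add.
Proof. by move=> f g h; apply: powserP => m /=; rewrite addrA. Qed.
Fact powser_addC : commutative powser_add.
Proof. by move=> f g; apply: powserP => m /=; rewrite addrC. Qed.
Fact powser_add0 : left_id powser0 powser_add.
Proof. by move=> f; apply: powserP => m /=; rewrite add0r. Qed.
Fact powser_addN : left_inverse powser0 powser_opp powser_add.
Proof. by move=> f; apply: powserP => m /=; rewrite addNr. Qed.

HB.instance Definition _ := GRing.isZmodule.Build (powser n K)
  powser_addA powser_addC powser_add0 powser_addN.

Fact powser_mulA : associative powser_mul.
Proof.
move=> f g h; apply: powserP => m; have md := ltnSn (mdeg m).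
rewrite !(coef_mul_ps _ _ md).
transitivity (mcoeff m (trunc_ps (mdeg m).+1 f *
  (trunc_ps (mdeg m).+1 g * trunc_ps (mdeg m).+1 h))).
  by apply: mcoeffM_eq => // k km; rewrite coef_trunc_ps // -coef_mul_ps.
by rewrite mulrA; apply: mcoeffM_eq => // k km; rewrite coef_trunc_ps // -coef_mul_ps.
Qed.

Fact powser_mulC : commutative powser_mul.
Proof.
move=> f g; apply: powserP => m; have md := ltnSn (mdeg m).
by rewrite !(coef_mul_ps _ _ md) mulrC.
Qed.

Fact powser_mul1 : left_id powser1 powser_mul.
Proof.
move=> f; apply: powserP => m; have md := ltnSn (mdeg m).
rewrite (coef_mul_ps _ _ md) -(coef_trunc_ps f md) -[in RHS](mul1r (trunc_ps _ _)).
by apply: mcoeffM_eq => // k km; rewrite coef_trunc_ps // mcoeff1.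
Qed.

Fact powser_mulDl : left_distributive powser_mul powser_add.
Proof.
move=> f g h; apply: powserP => m /=; rewrite -big_split /=.
by apply: eq_bigr => k _; rewrite mulrDl.
Qed.

Fact powser1_neq0 : powser1 != 0.
Proof.
apply/eqP => /(congr1 (fun f => coefps f mnm0)) /= /eqP.
by rewrite eqxx oner_eq0.
Qed.

HB.instance Definition _ := GRing.Zmodule_isComNzRing.Build (powser n K)
  powser_mulA powser_mulC powser_mul1 powser_mulDl powser1_neq0.

Definition pderivps (j : 'I_n) f : A := PowSer (fun m =>
  coefps f (mnm_add m (mnm1 j)) *+ (m j).+1).

(* The maximal ideal of the local ring K[[x_1, ..., x_n]] when K is a field. *)
Definition maxps : set A := [set f | coefps f mnm0 = 0].

End PowerSeriesRing.

(* The closed subscheme Spec(A/I) is given by the ideal I of A. *)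

Section CommutativeAlgebra.
Context (A : comNzRingType).
Implicit Types (I J P S : set A).

Definition ideal I : Prop :=
  [/\ I 0, forall a b, I a -> I b -> I (a + b)
    & forall a b, I b -> I (a * b)].

Definition ideal_gen S : set A := smallest ideal S.

Definition ideal_add I J : set A := [set a + b | a in I & b in J].

Definition ideal_exp I (k : nat) : set A :=
  ideal_gen [set \prod_(i < k) a i | a in [set a : 'I_k -> A | forall i, I (a i)]].

Definition prime_ideal P : Prop :=
  [/\ ideal P, ~ P 1 & forall a b, P (a * b) -> P a \/ P b].

(* The underlying closed set V(I) of Spec(A/I), as a set of primes of A. *)
Definition zero_locus I : set (set A) := [set P | prime_ideal P /\ I `<=` P].

Definition reduced_subscheme I : Prop :=
  forall (a : A) (k : nat), I (a ^+ k) -> I a.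

Definition irreducible_subscheme I : Prop :=
  zero_locus I !=set0 /\
  forall J1 J2, ideal J1 -> ideal J2 ->
    zero_locus I `<=` zero_locus J1 `|` zero_locus J2 ->
    zero_locus I `<=` zero_locus J1 \/ zero_locus I `<=` zero_locus J2.

(* Strictly increasing chains c 0 < c 1 < ... < c l of elements of C. *)
Definition strict_chain (C : set (set A)) (l : nat) (c : nat -> set A) : Prop :=
  (forall i, (i <= l)%N -> C (c i)) /\ (forall i, (i < l)%N -> c i `<` c i.+1).

Definition has_chain (C : set (set A)) (l : nat) : Prop :=
  exists c, strict_chain C l c.

(* [l] is the maximal length of a strict chain in [C]. *)
Definition chain_sup (C : set (set A)) (l : nat) : Prop :=
  has_chain C l /\ ~ has_chain C l.+1.

(* Krull dimension of A/I: the primes of A/I are the primes of A above I. *)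
Definition dim_ge I (d : nat) : Prop := has_chain (zero_locus I) d.
Definition dim_eq I (d : nat) : Prop := chain_sup (zero_locus I) d.

(* The value is 0 by convention when A/I is zero or has infinite dimension. *)
Definition krull_dim I : nat := xget 0%N [set d | dim_eq I d].

(* Length of the A-module A/I, whose submodules are the J/I for J an ideal of A
   containing I; it is 0 by convention when the length is infinite. *)
Definition quot_length I : nat :=
  xget 0%N [set l | chain_sup [set J | ideal J /\ I `<=` J] l].

(* e(A/I, M) = lim_k d! lambda(R/M^(k+1)R) / k^d for R = A/I and d = dim R; here
   R/M^(k+1)R = A/(I + M^(k+1)). *)
Definition multiplicity (R : realType) (M I : set A) : R :=
  limn (fun k : nat =>
    (krull_dim I)`!%:R * (quot_length (ideal_add I (ideal_exp M k.+1)))%:R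
      / k%:R ^+ krull_dim I : R).

End CommutativeAlgebra.

Section Singular.
Context (n : nat) (K : comNzRingType).
Local Notation A := (powser n K).

Definition jacobian (k : nat) (f : 'I_k -> A) : 'M[A]_(k, n) :=
  \matrix_(i, j) pderivps j (f i).

Definition minors (r p q : nat) (M : 'M[A]_(p, q)) : set A :=
  [set a | exists (s : 'I_r -> 'I_p) (t : 'I_r -> 'I_q),
     [/\ {homo s : i j / (i < j)%N}, {homo t : i j / (i < j)%N}
       & a = \det (mxsub s t M)]].

(* [I] is finitely generated since A is Noetherian, and the ideal S below does
   not depend on the chosen generators f.  The subtraction [n - alpha] is
   truncated: this is meant for alpha <= n. *)
Definition sing_ideal_at (alpha : nat) (I : set A) : set A :=
  xget setT [set S | exists (k : nat) (f : 'I_k -> A),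
    I = ideal_gen (range f) /\
    S = ideal_add I (ideal_gen (minors (n - alpha) (jacobian f)))].

(* Only meaningful for A/I equidimensional, as is the case of the hyperplane
   sections of an irreducible subvariety not contained in the hyperplane. *)
Definition sing_ideal (I : set A) : set A := sing_ideal_at (krull_dim I) I.

(* The scheme-theoretic intersection of Spec(A/I) with the hypersurface h = 0. *)
Definition section_ideal (I : set A) (h : A) : set A :=
  ideal_add I (ideal_gen [set h]).

End Singular.

(* Main.v *)
(* For an ideal J let hilb J k count the monomials of degree at most k that are not
   initial monomials of J; it is the length of A/(J + m^(k+1)), and there is a
   chain of primes of length d above J exactly when hilb J is not O(k^(d-1)).
   If, for some k, every set T of d+1 variables supports an initial monomial of J of degree at most k,
   then a standard monomial has at most d exponents that are at least k, so that
   hilb J N <= (k+1)^n (N+1)^d and the multiplicity in dimension d is bounded in terms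
   of k.  Hence unbounded multiplicities give, for each k, some h = h_i and some T such
   that no monomial in T of degree at most k is initial for the ideal of the singular
   scheme of X n H.  This is a decreasing sequence of first-order conditions on the
   coefficients of h, because dim (X n H) = dim X - 1, and with it the size of the
   Jacobian minors, does not depend on h.  An uncountable algebraically closed field
   is aleph_1-saturated, so one h satisfies all of them. *)

Require Import Defs.
From HB Require Import structures.
From mathcomp Require Import all_boot all_order all_algebra.
From mathcomp Require Import fingroup perm closed_field.
From mathcomp Require Import -(notations) mpoly.
From mathcomp Require Import boolp classical_sets cardinality reals topology.
From mathcomp Require Import normedtype sequences.
From mathcomp Require Import zify.
Set Implicit Arguments.
Unset Strict Implicit.
Unset Printing Implicit Defensive.
Import Order.TTheory GRing.Theory Num.Theory numFieldNormedType.Exports.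
Local Open Scope classical_set_scope.
Local Open Scope ring_scope.

(** * Saturation of uncountable algebraically closed fields *)

(** Dimension is read off from the coarse dichotomy [small d (hilb J)], which is controlled by a
    single tool: the additivity of [hilb] under adjoining an element and passing to the colon ideal.
    Large growth produces chains of primes directly. The converse meets an obstacle: the truncated
    colon of a prime by an outside element is larger than the prime, and Artin-Rees bounds the
    discrepancy by a constant shift of degree. Artin-Rees, Noetherianity and locality all come from
    one division algorithm, whose finite basis is given by Dickson's lemma. On the logical side,
    being an initial monomial of an ideal quantifies over power series, that is over infinitely many
    field elements; but a given leading monomial depends on finitely many coefficients, so finitely
    many quantifiers suffice. This requires generators of the singular ideal that are indexed by a
    fixed finite type and polynomial in the coefficients of h, whereas [sing_ideal_at] picks
    generators by choice; hence the work on minors. The set T is quantified inside each condition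
    and may change with k. *)

Section Definable.
Variable K : closedFieldType.
Implicit Types (s : nat -> K) (P Q : (nat -> K) -> Prop).

Definition upd s (i : nat) (x : K) : nat -> K := fun j => if j == i then x else s j.

(** Assignments have infinitely many coordinates, while a term reads a finite list. Agreement is
    demanded on every prefix of length at least [N], so that two bounds combine by taking their
    maximum. *)
Definition polyfun (F : (nat -> K) -> K) : Prop :=
  exists N (t : GRing.term K), forall s M, (N <= M)%N -> F s = GRing.eval (mkseq s M) t.

Definition definable P : Prop :=
  exists N (f : GRing.formula K), forall s M, (N <= M)%N ->
    (P s <-> GRing.holds (mkseq s M) f).

Lemma polyfun_const c : polyfun (fun=> c).
Proof. by exists 0%N, (GRing.Const c). Qed.

Lemma polyfun_var i : polyfun (fun s => s i).
Proof. by exists i.+1, (GRing.Var K i) => s M iM /=; rewrite nth_mkseq. Qed.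

Lemma polyfunD F G : polyfun F -> polyfun G -> polyfun (fun s => F s + G s).
Proof.
move=> [N [t Ht]] [N' [t' Ht']]; exists (maxn N N'), (GRing.Add t t') => s M.
by rewrite geq_max => /andP[NM N'M] /=; rewrite -Ht // -Ht'.
Qed.

Lemma polyfunM F G : polyfun F -> polyfun G -> polyfun (fun s => F s * G s).
Proof.
move=> [N [t Ht]] [N' [t' Ht']]; exists (maxn N N'), (GRing.Mul t t') => s M.
by rewrite geq_max => /andP[NM N'M] /=; rewrite -Ht // -Ht'.
Qed.

Lemma polyfun_sum (J : Type) (r : seq J) (p : pred J) F :
  (forall j, p j -> polyfun (F j)) -> polyfun (fun s => \sum_(j <- r | p j) F j s).
Proof.
move=> pF; elim: r => [|j r IHr].
  rewrite (_ : (fun s => _) = fun=> 0); first exact: polyfun_const.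
  by apply/funext => s; rewrite big_nil.
case pj: (p j); last first.
  by congr polyfun: IHr; apply/funext => s; rewrite big_cons pj.
have := polyfunD (pF j pj) IHr.
by congr polyfun; apply/funext => s; rewrite big_cons pj.
Qed.

Lemma definable_ext P Q : (forall s, P s <-> Q s) -> definable P -> definable Q.
Proof. by move=> PQ; rewrite (_ : P = Q) //; apply/funext => s; apply/propext/PQ. Qed.

Lemma definable_eq0 F : polyfun F -> definable (fun s => F s = 0).
Proof.
move=> [N [t Ht]]; exists N, (GRing.Equal t (GRing.Const 0)) => s M NM /=.
by rewrite (Ht _ _ NM).
Qed.

Lemma definable_and P Q : definable P -> definable Q -> definable (fun s => P s /\ Q s).
Proof.
move=> [N [f Hf]] [N' [g Hg]]; exists (maxn N N'), (GRing.And f g) => s M.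
by rewrite geq_max => /andP[NM N'M] /=; rewrite -Hf // -Hg.
Qed.

Lemma definable_not P : definable P -> definable (fun s => ~ P s).
Proof.
by move=> [N [f Hf]]; exists N, (GRing.Not f) => s M NM /=; rewrite -Hf.
Qed.

Lemma definable_all (J : eqType) (r : seq J) (P : J -> (nat -> K) -> Prop) :
  (forall j, j \in r -> definable (P j)) ->
  definable (fun s => forall j, j \in r -> P j s).
Proof.
elim: r => [|j r IHr] dP; first by exists 0%N, (GRing.Bool true).
apply: (@definable_ext (fun s => P j s /\ forall i, i \in r -> P i s)).
  move=> s; split=> [[Pj Pr] i|Ps].
    by rewrite inE => /predU1P[->|/Pr].
  by split=> [|i ir]; apply: Ps; rewrite inE ?eqxx ?ir ?orbT.
apply: definable_and; first by apply: dP; rewrite inE eqxx.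
by apply: IHr => i ir; apply: dP; rewrite inE ir orbT.
Qed.

Lemma definable_has (J : eqType) (r : seq J) (P : J -> (nat -> K) -> Prop) :
  (forall j, j \in r -> definable (P j)) ->
  definable (fun s => exists2 j, j \in r & P j s).
Proof.
move=> dP.
apply: (@definable_ext (fun s => ~ forall j, j \in r -> ~ P j s)).
  move=> s; split=> [/existsNP[j /not_implyP[jr /contrapT Pj]]|[j jr Pj]].
    by exists j.
  by move/(_ j jr).
by apply/definable_not/definable_all => j jr; apply/definable_not/dP.
Qed.

(** Infinitely many coordinates may lie outside [W], yet the formula reads only those below [N]:
    existential quantifiers over the finite list [I] express the whole quantifier. *)
Lemma definable_exists (W : pred nat) P : definable P ->
  definable (fun s => exists s', (forall v, W v -> s' v = s v) /\ P s').
Proof.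
move=> [N [f Hf]]; pose I := [seq i <- iota 0 N | ~~ W i].
have memI i : (i \in I) = (i < N)%N && ~~ W i.
  by rewrite mem_filter mem_iota andbC.
exists N, (foldr GRing.Exists f I) => s M NM; rewrite -GRing.foldExistsP; split.
  move=> [s' [ss' Ps']]; pose s2 i := if i \in I then s' i else s i.
  exists (mkseq s2 M).
    move=> i iI; have {iI}/negPf iI : i \notin I by [].
    have [iM|Mi] := ltnP i M; first by rewrite !nth_mkseq // /s2 iI.
    by rewrite !nth_default ?size_mkseq.
  rewrite -(Hf s2 M NM) (Hf s2 N (leqnn N)).
  suff -> : mkseq s2 N = mkseq s' N by rewrite -Hf.
  apply/eq_in_map => i; rewrite mem_iota add0n => /= iN.
  by rewrite /s2 memI iN /=; case: ifPn => // /negPn/ss'.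
move=> [e' ee' fe']; pose s' i := if i \in I then e'`_i else s i.
exists s'; split=> [v Wv|]; first by rewrite /s' memI Wv andbF.
rewrite (Hf s' M NM); apply: GRing.eq_holds fe' => i.
have [iM|Mi] := ltnP i M.
  rewrite nth_mkseq // /s'; case: ifPn => // iI.
  by rewrite -(ee' i) ?nth_mkseq.
rewrite (nth_default _ (s := mkseq s' M)) ?size_mkseq //.
rewrite -(ee' i) ?nth_default ?size_mkseq //.
by rewrite inE memI negb_and -leqNgt (leq_trans NM Mi).
Qed.

Definition fin_or_cofin (A : K -> Prop) : Prop :=
  exists r : seq K, (forall x, A x -> x \in r) \/ (forall x, ~ A x -> x \in r).

Lemma fin_or_cofin_and A B :
  fin_or_cofin A -> fin_or_cofin B -> fin_or_cofin (fun x => A x /\ B x).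
Proof.
move=> [r [rA|rA]] [r' [rB|rB]].
- by exists r; left=> x [/rA].
- by exists r; left=> x [/rA].
- by exists r'; left=> x [_ /rB].
exists (r ++ r'); right=> x /not_andP[/rA|/rB]; rewrite mem_cat => ->//.
by rewrite orbT.
Qed.

Lemma fin_or_cofin_not A : fin_or_cofin A -> fin_or_cofin (fun x => ~ A x).
Proof.
move=> [r [rA|rA]]; exists r; [right|left] => //.
by move=> x /contrapT/rA.
Qed.

Lemma fin_or_cofin_ext A B : (forall x, A x <-> B x) ->
  fin_or_cofin A -> fin_or_cofin B.
Proof. by move=> AB; rewrite (_ : A = B) //; apply/funext => s; apply/propext/AB. Qed.

Lemma eval_horner (e : seq K) (i : nat) (t : GRing.term K) : GRing.rterm t ->
  exists p : {poly K}, forall x, GRing.eval (set_nth 0 e i x) t = p.[x].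
Proof.
elim: t => //=.
- move=> j _; have [->|ji] := eqVneq j i.
    by exists 'X => x; rewrite nth_set_nth /= eqxx hornerX.
  by exists (e`_j)%:P => x; rewrite nth_set_nth /= (negPf ji) hornerC.
- by move=> c _; exists c%:P => x; rewrite hornerC.
- by move=> m _; exists m%:R => x; rewrite -polyC_natr hornerC.
- move=> t1 IH1 t2 IH2 /andP[/IH1[p Hp] /IH2[q Hq]].
  by exists (p + q) => x; rewrite hornerD Hp Hq.
- by move=> t1 IH1 /IH1[p Hp]; exists (- p) => x; rewrite hornerN Hp.
- by move=> t1 IH1 m /IH1[p Hp]; exists (p *+ m) => x; rewrite hornerMn Hp.
- move=> t1 IH1 t2 IH2 /andP[/IH1[p Hp] /IH2[q Hq]].
  by exists (p * q) => x; rewrite hornerM Hp Hq.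
- by move=> t1 IH1 m /IH1[p Hp]; exists (p ^+ m) => x; rewrite horner_exp Hp.
Qed.

(** Strong minimality: an equation in one unknown holds identically or confines it to the roots of a
    nonzero polynomial, and being finite or cofinite is stable under Boolean operations. *)
Lemma qf_fin_or_cofin (e : seq K) (i : nat) (f : GRing.formula K) :
  GRing.qf_form f && GRing.rformula f ->
  fin_or_cofin (fun x => GRing.qf_eval (set_nth 0 e i x) f).
Proof.
elim: f => //=.
- by case=> _; exists [::]; [right|left].
- move=> t1 t2 /andP[/(eval_horner e i)[p Hp] /(eval_horner e i)[q Hq]].
  have [pq|pq] := eqVneq (p - q) 0.
    by exists [::]; right=> x []; rewrite Hp Hq; move/subr0_eq: pq => ->; apply/eqP.
  have [r Er] := closed_field_poly_normal (p - q).
  exists r; left=> x; rewrite Hp Hq -subr_eq0 -hornerN -hornerD => rt.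
  move: (rt : root (p - q) x); rewrite Er rootZ ?lead_coef_eq0 //.
  by rewrite root_prod_XsubC.
- move=> f IHf g IHg /andP[/andP[qf qg] /andP[rf rg]].
  have {}IHf := IHf (introT andP (conj qf rf)).
  have {}IHg := IHg (introT andP (conj qg rg)).
  apply: fin_or_cofin_ext (fin_or_cofin_and IHf IHg).
  by move=> x; apply: rwP; apply: andP.
- move=> f IHf g IHg /andP[/andP[qf qg] /andP[rf rg]].
  have {}IHf := IHf (introT andP (conj qf rf)).
  have {}IHg := IHg (introT andP (conj qg rg)).
  apply: fin_or_cofin_ext (fin_or_cofin_not
    (fin_or_cofin_and (fin_or_cofin_not IHf) (fin_or_cofin_not IHg))).
  move=> x; rewrite -(rwP orP); split=> [/not_andP[/contrapT|/contrapT]|[fx|gx] []//].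
    by left.
  by right.
- move=> f IHf g IHg /andP[/andP[qf qg] /andP[rf rg]].
  have {}IHf := IHf (introT andP (conj qf rf)).
  have {}IHg := IHg (introT andP (conj qg rg)).
  apply: fin_or_cofin_ext (fin_or_cofin_not
    (fin_or_cofin_and IHf (fin_or_cofin_not IHg))).
  move=> x; rewrite -(rwP implyP); split=> [/not_andP[fx /fx|/contrapT]|fg [/fg]] //.
- move=> f IHf /IHf{}IHf.
  apply: fin_or_cofin_ext (fin_or_cofin_not IHf) => x.
  by apply: rwP; apply: negP.
Qed.

Lemma definable_fibre P s i : definable P -> fin_or_cofin (fun x => P (upd s i x)).
Proof.
(* The prefix has to contain position [i], the one that varies. *)
move=> [N [f Hf]]; pose M := maxn N i.+1.
have iM : (i < M)%N by rewrite leq_max leqnn orbT.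
have E x : mkseq (upd s i x) M = set_nth 0 (mkseq s M) i x.
  apply: (@eq_from_nth _ 0) => [|j]; rewrite size_mkseq.
    by rewrite size_set_nth size_mkseq; apply/esym/maxn_idPr.
  by move=> jM; rewrite nth_set_nth /= !nth_mkseq.
have clK : GRing.closed_field_axiom K := @solve_monicpoly K.
pose g := GRing.quantifier_elim (@ClosedFieldQE.ex_elim K) (GRing.to_rform f).
have wg : GRing.qf_form g && GRing.rformula g.
  apply: GRing.quantifier_elim_wf (GRing.to_rform_rformula f).
  exact: ClosedFieldQE.wf_ex_elim.
apply: fin_or_cofin_ext (qf_fin_or_cofin (mkseq s M) i wg) => x.
rewrite (Hf (upd s i x) M (leq_maxl _ _)) E -(GRing.to_rformP _ f).
apply: iff_sym; apply: rwP; apply: GRing.quantifier_elim_rformP.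
- exact: ClosedFieldQE.wf_ex_elim.
- exact: ClosedFieldQE.holds_ex_elim.
- exact: GRing.to_rform_rformula.
Qed.

(** If every set is cofinite, the complements cover only countably many points of an uncountable
    field. Otherwise some set is finite, and a decreasing sequence of nonempty sets inside it has a
    common point. *)
Lemma fin_or_cofin_bigcap (Z : nat -> K -> Prop) :
  ~ countable [set: K] -> (forall k, fin_or_cofin (Z k)) ->
  (forall k x, Z k.+1 x -> Z k x) -> (forall k, exists x, Z k x) ->
  exists x, forall k, Z k x.
Proof.
move=> Kunc fc dec ne.
have decl k l x : (k <= l)%N -> Z l x -> Z k x.
  elim: l => [|l IHl]; first by rewrite leqn0 => /eqP->.
  by rewrite leq_eqVlt => /predU1P[->//|kl] /dec/IHl; apply.
have [allco|] := pselect (forall k, exists r : seq K, forall x, ~ Z k x -> x \in r).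
  have [r Hr] := choice allco.
  apply: contrapT => /forallNP nZ; apply: Kunc.
  have : countable (\bigcup_(k in [set: nat]) [set x | x \in r k]).
    by apply: bigcup_countable => // k _; apply/finite_set_countable/finite_seq.
  apply: sub_countable; apply: subset_card_le => x _.
  by have /existsNP[k nZk] := nZ x; exists k => //; apply: Hr.
move=> /existsNP[k0 nco]; have [r [fin|co]] := fc k0; last by case: nco; exists r.
apply: contrapT => /forallNP nZ.
have /choice[kk Hkk] : forall x, exists k, ~ Z k x by move=> x; apply/existsNP/nZ.
(* By level [L] every point of the finite list [r] has dropped out: the sum bounds each [kk x]. *)
pose L := (k0 + \sum_(x <- r) kk x)%N.
have [x Zx] := ne L.
have xr : x \in r by apply: fin; apply: decl Zx; rewrite leq_addr.
case: (Hkk x); apply: decl Zx.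
by rewrite /L (big_rem x) //= addnCA leq_addr.
Qed.

(* Uncountable algebraically closed fields are aleph_1-saturated: choose the
   coordinates one after the other; the admissible values of the next coordinate
   form, at each level, a finite or cofinite set by quantifier elimination. *)
Lemma definable_saturation (P : nat -> (nat -> K) -> Prop) :
  ~ countable [set: K] -> (forall k, definable (P k)) ->
  (forall k s, P k.+1 s -> P k s) -> (forall k, exists s, P k s) ->
  exists s, forall k, P k s.
Proof.
move=> Kunc dP dec ne.
(* [E i k s] says that the first [i] coordinates of [s] extend to a solution of level [k]. The
   construction preserves this for all [k] at once. *)
pose E i k s := exists s', (forall v, (v < i)%N -> s' v = s v) /\ P k s'.
have step i s : (forall k, E i k s) -> exists x, forall k, E i.+1 k (upd s i x).
  move=> Es; apply: fin_or_cofin_bigcap => // k.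
  - by apply: definable_fibre; apply: definable_exists (dP k).
  - by move=> x [s' [ss' Ps']]; exists s'; split=> //; apply: dec.
  have [s' [ss' Ps']] := Es k; exists (s' i), s'; split=> // v.
  by rewrite ltnS leq_eqVlt /upd; case: eqVneq => [->//|_] /= /ss'.
have /choice[nx Hnx] : forall p : nat * (nat -> K), exists x,
    (forall k, E p.1 k p.2) -> forall k, E p.1.+1 k (upd p.2 p.1 x).
  move=> [i s] /=; have [/step[x Hx]|nE] := pselect (forall k, E i k s).
    by exists x.
  by exists 0 => /nE.
pose fix S i : nat -> K :=
  if i is j.+1 then upd (S j) j (nx (j, S j)) else fun=> 0.
have ES i k : E i k (S i).
  elim: i k => [|i IHi] k; last exact: (Hnx (i, S i)).
  by have [s Ps] := ne k; exists s.
have Sst i j v : (v < i)%N -> (i <= j)%N -> S j v = S i v.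
  move=> vi; elim: j => [|j IHj]; first by rewrite leqn0 => /eqP->.
  rewrite leq_eqVlt => /predU1P[->//|ij].
  by rewrite /= /upd ltn_eqF ?(leq_trans vi) // IHj.
(* [P k] reads only [N] coordinates; there the diagonal sequence agrees with [S N], and [S N]
   extends to a solution of level [k]. *)
exists (fun j => S j.+1 j) => k; have [N [f Hf]] := dP k.
rewrite (Hf _ N) //; have [s' [ss' Ps']] := ES N k.
move: Ps'; rewrite (Hf _ N) // (_ : mkseq s' N = mkseq (fun j => S j.+1 j) N) //.
apply/eq_in_map => i; rewrite mem_iota add0n => /= iN.
by rewrite ss' //; apply: (Sst i.+1 N).
Qed.

End Definable.

(** * Initial monomials and division in K[[x_1, ..., x_n]] *)

Section Ideals.
Variable A : comNzRingType.
Implicit Types (J L E : set A).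

Lemma idealN J a : ideal J -> J a -> J (- a).
Proof. by move=> [_ _ JM] Ja; rewrite -mulN1r; apply: JM. Qed.

Lemma idealB J a b : ideal J -> J a -> J b -> J (a - b).
Proof. by move=> iJ Ja Jb; case: (iJ) => _ JD _; apply: JD => //; apply: idealN. Qed.

Lemma ideal_sum J (T : Type) (r : seq T) (p : pred T) (F : T -> A) :
  ideal J -> (forall i, p i -> J (F i)) -> J (\sum_(i <- r | p i) F i).
Proof. by move=> [J0 JD _] JF; elim/big_ind: _. Qed.

Lemma ideal_gen_ideal (S : set A) : ideal (ideal_gen S).
Proof.
split=> [J [[J0 _ _] _] //|a b Sa Sb J [iJ SJ]|a b Sb J [iJ SJ]].
  by case: (iJ) => _ JD _; apply: JD; [apply: Sa|apply: Sb].
by case: (iJ) => _ _ JM; apply: JM; apply: Sb.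
Qed.

Lemma ideal_gen_sub (S J : set A) : ideal J -> S `<=` J -> ideal_gen S `<=` J.
Proof. by move=> iJ SJ a; apply. Qed.

Lemma sub_ideal_gen (S : set A) : S `<=` ideal_gen S.
Proof. by move=> a Sa J [_]; apply. Qed.

Lemma ideal_gen_span (T : finType) (F : T -> A) :
  ideal_gen (range F) = [set \sum_i a i * F i | a in [set: T -> A]].
Proof.
apply/seteqP; split.
  apply: ideal_gen_sub => [|_ [j _ <-]].
    split.
    - by exists (fun=> 0) => //; rewrite big1 // => i _; rewrite mul0r.
    - move=> _ _ [a _ <-] [b _ <-]; exists (fun i => a i + b i) => //.
      by rewrite -big_split; apply: eq_bigr => i _; rewrite mulrDl.
    - move=> a _ [b _ <-]; exists (fun i => a * b i) => //.
      by rewrite mulr_sumr; apply: eq_bigr => i _; rewrite mulrA.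
  exists (fun i => (i == j)%:R) => //.
  rewrite (bigD1 j) //= eqxx mul1r big1 ?addr0 // => i /negPf ->.
  by rewrite mul0r.
move=> _ [a _ <-]; apply: ideal_sum (ideal_gen_ideal _) _ => i _.
have [_ _ M] := ideal_gen_ideal (range F).
by apply: M; apply: sub_ideal_gen; exists i.
Qed.

Lemma ideal_gen1E (h : A) : ideal_gen [set h] = [set a * h | a in [set: A]].
Proof.
have -> : [set h] = range (fun _ : unit => h).
  by apply/seteqP; split=> [x ->|x [y _ <-]] //; exists tt.
rewrite ideal_gen_span; apply/seteqP; split=> _ [a _ <-].
  by exists (\sum_i a i) => //; rewrite -mulr_suml.
by exists (fun=> a) => //; rewrite (bigD1 tt) //= big1 ?addr0 // => -[].
Qed.

Lemma ideal_add_ideal J L : ideal J -> ideal L -> ideal (ideal_add J L).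
Proof.
move=> [J0 JD JM] [L0 LD LM]; split.
- by exists 0 => //; exists 0 => //; rewrite addr0.
- move=> _ _ [a Ja [b Lb <-]] [c Jc [e Le <-]].
  by exists (a + c); [exact: JD|exists (b + e); [exact: LD|rewrite addrACA]].
- move=> x _ [a Ja [b Lb <-]].
  by exists (x * a); [exact: JM|exists (x * b); [exact: LM|rewrite mulrDr]].
Qed.

Lemma ideal_addl J L : ideal L -> J `<=` ideal_add J L.
Proof. by move=> [L0 _ _] a Ja; exists a => //; exists 0 => //; rewrite addr0. Qed.

Lemma ideal_addr J L : ideal J -> L `<=` ideal_add J L.
Proof. by move=> [J0 _ _] a La; exists 0 => //; exists a => //; rewrite add0r. Qed.

Lemma ideal_add_sub J L E : ideal E -> J `<=` E -> L `<=` E -> ideal_add J L `<=` E.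
Proof. by move=> [_ ED _] JE LE _ [a Ja [b Lb <-]]; apply: ED; [apply: JE|apply: LE]. Qed.

End Ideals.

Section Monomials.
Variable n : nat.
Local Notation mon := (multinom n).

(** Each next index is one at which [v] attains its minimum over the remaining tail. *)
Lemma nat_monotone_subseq (v : nat -> nat) :
  exists phi : nat -> nat, (forall i, (phi i < phi i.+1)%N) /\
    forall i j, (i <= j)%N -> (v (phi i) <= v (phi j))%N.
Proof.
have /choice[f Hf] : forall N, exists i, (N <= i)%N /\ forall j, (N <= j)%N -> (v i <= v j)%N.
  move=> N; have ex : exists x, `[< exists2 i, (N <= i)%N & v i = x >].
    by exists (v N); apply/asboolP; exists N.
  case: (ex_minnP ex) => x /asboolP[i Ni <-] Hx; exists i; split=> // j Nj.
  by apply: Hx; apply/asboolP; exists j.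
pose fix phi i := if i is j.+1 then f (phi j).+1 else f 0%N.
have phiS i : (phi i < phi i.+1)%N by have [] := Hf (phi i).+1.
exists phi; split=> // i j ij.
have [N [Ni Hi]] : exists N, (N <= phi i)%N /\ forall j, (N <= j)%N -> (v (phi i) <= v j)%N.
  by case: i {ij} => [|i]; eexists; apply: Hf.
apply/Hi/(leq_trans Ni) => {Hi}.
elim: j ij => [|j IHj]; first by rewrite leqn0 => /eqP <-.
rewrite leq_eqVlt => /predU1P[<- //|/IHj/leq_trans]; apply.
exact: ltnW.
Qed.

(** Monotone subsequences are extracted for one exponent after the other. *)
Lemma dickson_seq (u : nat -> mon) : exists i j, (i < j)%N /\ mpoly.lem (u i) (u j).
Proof.
suff [phi [phiS Hphi]] : exists phi : nat -> nat, (forall i, (phi i < phi i.+1)%N) /\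
    forall (c : 'I_n) i j, c \in enum 'I_n -> (i <= j)%N -> (u (phi i) c <= u (phi j) c)%N.
  exists (phi 0%N), (phi 1%N); split=> //; apply/mnm_lepP => c.
  by apply: Hphi; rewrite ?mem_enum.
elim: (enum 'I_n) => [|c r [phi [phiS Hphi]]]; first by exists id.
have [psi [psiS Hpsi]] := nat_monotone_subseq (fun i => u (phi i) c).
have mono (f : nat -> nat) : (forall i, (f i < f i.+1)%N) -> forall i j, (i <= j)%N -> (f i <= f j)%N.
  move=> fS i; elim=> [|j IHj]; first by rewrite leqn0 => /eqP ->.
  by rewrite leq_eqVlt => /predU1P[->//|/IHj/leq_trans]; apply; apply: ltnW.
exists (phi \o psi); split=> [i|e i j] /=.
  by apply: leq_trans (phiS _) _; apply: mono.
rewrite inE => /predU1P[->|er] ij; first exact: Hpsi.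
by apply: Hphi => //; apply: mono.
Qed.

(** Otherwise one could keep choosing elements of [E] divisible by no earlier choice, against
    [dickson_seq]. *)
Lemma dickson (E : set mon) : exists r : seq mon,
  (forall m, m \in r -> E m) /\ forall m, E m -> exists2 e, e \in r & mpoly.lem e m.
Proof.
apply: contrapT => /forallNP nE.
have /choice[g Hg] : forall r : seq mon, exists m, (forall m, m \in r -> E m) ->
    E m /\ forall e, e \in r -> ~~ mpoly.lem e m.
  move=> r; have [rE|] := pselect (forall m, m \in r -> E m); last by exists mnm0.
  have /not_andP[//|/existsNP[m /not_implyP[Em Hm]]] := nE r.
  by exists m => _; split=> // e er; apply/negP => em; apply: Hm; exists e.
pose fix l i := if i is j.+1 then rcons (l j) (g (l j)) else [::].
have lE i m : m \in l i -> E m.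
  elim: i m => [//|i IHi] m; rewrite /= mem_rcons inE => /predU1P[->|/IHi//].
  by have [] := Hg (l i) IHi.
have gl i j : (i < j)%N -> g (l i) \in l j.
  elim: j => [//|j IHj]; rewrite ltnS leq_eqVlt /= mem_rcons inE.
  by move=> /predU1P[->|/IHj ->]; rewrite ?eqxx ?orbT.
have [i [j [ij]]] := dickson_seq (fun i => g (l i)).
by apply/negP; have [_] := Hg (l j) (@lE j); apply; apply: gl.
Qed.

End Monomials.

Section LeadingMonomials.
Variables (n : nat) (K : fieldType).
Local Notation mon := (multinom n).
Local Notation A := (powser n K).
Implicit Types (f g : A) (m : mon) (J L E : set A).

(** Membership in the k-th power of the maximal ideal, as [ideal_exp_ordge] and [ordge_ideal_exp]
    show, in a form tested on coefficients. *)
Definition ordge (k : nat) f : Prop := forall m, (mdeg m < k)%N -> coefps f m = 0.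

(* The order on monomials compares degrees first; the leading monomial of a power
   series is the smallest one. *)
Definition is_lead f m : Prop :=
  coefps f m != 0 /\ forall m', (m' < m)%O -> coefps f m' = 0.

Definition cmon (c : K) (u : mon) : A := PowSer (fun m => if m == u then c else 0).

Lemma coefps_sum (T : Type) (r : seq T) (p : pred T) (F : T -> A) m :
  coefps (\sum_(i <- r | p i) F i) m = \sum_(i <- r | p i) coefps (F i) m.
Proof. by elim/big_rec2: _ => // i x y _ <-. Qed.

Lemma coefpsD f g m : coefps (f + g) m = coefps f m + coefps g m.
Proof. by []. Qed.

Lemma coefpsB f g m : coefps (f - g) m = coefps f m - coefps g m.
Proof. by []. Qed.

Lemma coefpsM f g m : coefps (f * g) m =
  \sum_(k : bmultinom n (mdeg m).+1 * bmultinom n (mdeg m).+1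
        | m == mnm_add (bmnm k.1) (bmnm k.2))
     coefps f (bmnm k.1) * coefps g (bmnm k.2).
Proof. by []. Qed.

Lemma coefpsM0 f g : coefps (f * g) mnm0 = coefps f mnm0 * coefps g mnm0.
Proof.
have d0 : (mdeg (mnm0 : mon) < (mdeg (mnm0 : mon)).+1)%N by [].
pose b0 : bmultinom n (mdeg (mnm0 : mon)).+1 := BMultinom d0.
rewrite coefpsM (bigD1 (b0, b0)) /= ?addm0 // big1 ?addr0 // => -[a b] /= /andP[/eqP e].
move/negP; case; move/esym/eqP: e; rewrite mnmD_eq0 => /andP[/eqP ea /eqP eb].
by apply/eqP; congr (_, _); apply/val_inj.
Qed.

Lemma coefps_cmonM c u f m :
  coefps (cmon c u * f) m = if mpoly.lem u m then c * coefps f (mnm_sub m u) else 0.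
Proof.
rewrite coefpsM; case: ifPn => [um|num].
  have du : (mdeg u < (mdeg m).+1)%N by rewrite ltnS -(submK um) mdegD leq_addl.
  have dv : (mdeg (mnm_sub m u) < (mdeg m).+1)%N by rewrite ltnS mdegB.
  rewrite (bigD1 (BMultinom du, BMultinom dv)) /=; last by rewrite addmC submK.
  rewrite eqxx big1 ?addr0 // => -[a b] /= /andP[/eqP e ne].
  case: eqP => [au|]; last by rewrite mul0r.
  case/eqP: ne; congr (_, _); apply/val_inj => //=.
  by have := congr1 (fun x => mnm_sub x u) e; rewrite au [mnm_add u _]addmC addmK.
rewrite big1 // => -[a b] /= /eqP e; case: eqP => [au|]; last by rewrite mul0r.
by case/negP: num; rewrite -au [X in mpoly.lem _ X]e lem_addr.
Qed.

Lemma coefps_scale c f m : coefps (cmon c mnm0 * f) m = c * coefps f m.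
Proof.
rewrite coefps_cmonM subm0 ifT //; by apply/mnm_lepP => i; rewrite mnm0E.
Qed.

Lemma is_lead_cmonM c u f m : c != 0 -> is_lead f m -> is_lead (cmon c u * f) (mnm_add u m).
Proof.
move=> c0 [fm fl]; split=> [|m' m'm]; rewrite coefps_cmonM.
  by rewrite lem_addr [mnm_add u m]addmC addmK mulf_neq0.
case: ifP => // um'; rewrite fl ?mulr0 //.
by move: m'm; rewrite -{1}(submK um') [mnm_add _ u]addmC ltmc_add2r.
Qed.

Lemma is_lead_ex f : f <> 0 -> exists m, is_lead f m.
Proof.
move=> f0; apply: contrapT => /forallNP nl; apply: f0; apply: powserP => m.
elim/(well_founded_ind (@ltom_wf n)): m => m IHm.
by apply: contrapT => /eqP fm; apply: (nl m).
Qed.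

Lemma ordge0 k : ordge k 0. Proof. by []. Qed.

Lemma ordgeD k f g : ordge k f -> ordge k g -> ordge k (f + g).
Proof. by move=> kf kg m mk; rewrite /= kf // kg // addr0. Qed.

Lemma ordgeB k f g : ordge k f -> ordge k g -> ordge k (f - g).
Proof. by move=> kf kg m mk; rewrite /= kf // kg // subr0. Qed.

Lemma ordge_sum k (T : Type) (r : seq T) (p : pred T) (F : T -> A) :
  (forall i, p i -> ordge k (F i)) -> ordge k (\sum_(i <- r | p i) F i).
Proof. by move=> kF; elim/big_ind: _ => //; apply: ordgeD. Qed.

Lemma ordgeW k l f : (l <= k)%N -> ordge k f -> ordge l f.
Proof. by move=> lk kf m ml; apply/kf/(leq_trans ml). Qed.

Lemma ordgeM k l f g : ordge k f -> ordge l g -> ordge (k + l) (f * g).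
Proof.
move=> kf lg m mkl; rewrite coefpsM big1 // => -[a b] /= /eqP e.
have [ak|ka] := ltnP (mdeg (bmnm a)) k; first by rewrite kf ?mul0r.
rewrite lg ?mulr0 //; have := congr1 (@mdeg n) e; rewrite mdegD; lia.
Qed.

Lemma ordgeMl k f g : ordge k g -> ordge k (f * g).
Proof. by move=> kg; rewrite -[k]add0n; apply: ordgeM. Qed.

Lemma ordge_ideal k : ideal (ordge k).
Proof. by split=> // [f g|f g]; [apply: ordgeD|apply: ordgeMl]. Qed.

Lemma ordge_lead k f m : is_lead f m -> (k <= mdeg m)%N -> ordge k f.
Proof. by move=> [_ fl] km m' m'k; apply/fl/lt_mdeg_ltmc/(leq_trans m'k). Qed.

Lemma lead_ordge k f m : is_lead f m -> ordge k f -> (k <= mdeg m)%N.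
Proof. by move=> [fm _] kf; rewrite leqNgt; apply/negP => /kf/eqP; apply/negP. Qed.

Lemma ordge_cmon c u : ordge (mdeg u) (cmon c u).
Proof. by move=> m mu /=; case: eqP mu => [->|//]; rewrite ltnn. Qed.

Definition lead_mon J m : Prop := exists2 f, J f & is_lead f m.

Lemma lead_mon_up J u m : ideal J -> lead_mon J m -> lead_mon J (mnm_add u m).
Proof.
move=> [_ _ JM] [f Jf fm]; exists (cmon 1 u * f); first exact: JM.
by apply: is_lead_cmonM => //; apply: oner_neq0.
Qed.

Lemma lead_mon_le J u m : ideal J -> mpoly.lem u m -> lead_mon J u -> lead_mon J m.
Proof. by move=> iJ um; rewrite -(submK um); apply: lead_mon_up. Qed.

(** Leading terms of degree [k] are cancelled one by one. Basis elements have leading degree at most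
    [c], so each multiplier has order at least [k - c]. *)
Lemma division_step L (s : nat) (F : 'I_s -> A) (mu : 'I_s -> mon) (c k : nat) f :
  ideal L -> (forall i, L (F i)) -> (forall i, is_lead (F i) (mu i)) ->
  (forall m, lead_mon L m -> exists i, mpoly.lem (mu i) m) ->
  (forall i, (mdeg (mu i) <= c)%N) -> L f -> ordge k f ->
  exists a : 'I_s -> A, (forall i, ordge (k - c) (a i)) /\
    ordge k.+1 (f - \sum_i a i * F i).
Proof.
move=> iL LF lF basis muc.
(* The termination measure: the number of monomials of degree at most [k] that are not below the
   leading monomial. *)
pose supp (g : A) := [set m : bmultinom n k.+1 |
  `[< exists2 m', (m' <= bmnm m)%O & coefps g m' != 0 >]]%SET.
move: {2}(#|supp f|) (leqnn #|supp f|) => N; elim: N f => [|N IHN] f SN Lf kf.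
  exists (fun=> 0); split=> //; rewrite big1 ?subr0 => [|i _]; last by rewrite mul0r.
  move=> m mk; apply: contrapT => /eqP fm.
  move: SN; rewrite leqn0 cards_eq0 => /eqP /setP /(_ (BMultinom mk)).
  by rewrite finset.in_set0 => /negP; apply; rewrite !inE; exists m.
have [fk|nfk] := pselect (ordge k.+1 f).
  by exists (fun=> 0); split=> //; rewrite big1 ?subr0 // => i _; rewrite mul0r.
have [m fm] : exists m, is_lead f m by apply: is_lead_ex => f0; apply: nfk; rewrite f0.
have mk : (mdeg m < k.+1)%N.
  by rewrite ltnNge; apply/negP => km; apply/nfk/(ordge_lead fm).
have km := lead_ordge fm kf.
have [i mui] := basis m (ex_intro2 _ _ f Lf fm).
pose q := cmon (coefps f m / coefps (F i) (mu i)) (mnm_sub m (mu i)).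
have dq : mdeg (mnm_sub m (mu i)) = (mdeg m - mdeg (mu i))%N.
  by rewrite -{2}(submK mui) mdegD addnK.
have qk : ordge (k - c) q.
  apply: (@ordgeW (mdeg (mnm_sub m (mu i)))); last exact: ordge_cmon.
  by rewrite dq; have := muc i; lia.
have Lg : L (f - q * F i) by apply: idealB => //; case: iL => _ _; apply.
have [fm0 fl] := fm; have [Fm0 Fl] := lF i.
have lq : is_lead (q * F i) m.
  rewrite -[X in is_lead _ X](submK mui); apply: is_lead_cmonM => //.
  by rewrite mulf_neq0 ?invr_neq0.
have gm m' : (m' <= m)%O -> coefps (f - q * F i) m' = 0.
  rewrite coefpsB le_eqVlt => /predU1P[->|m'm].
    rewrite coefps_cmonM; have -> : mpoly.lem (mnm_sub m (mu i)) m by apply: lem_subr.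
    by rewrite submBA // [mnm_add m _]addmC addmK divfK // subrr.
  by rewrite fl // (proj2 lq) // subrr.
have kg : ordge k (f - q * F i).
  by apply: ordgeB => //; apply: ordge_lead lq km.
have SgN : (#|supp (f - q * F i)%R| <= N)%N.
  rewrite -ltnS; apply: leq_trans SN; apply/proper_card/properP; split.
    apply/fintype.subsetP => m1; rewrite !inE => -[m' m'm1 gm'].
    exists m => //; apply: le_trans m'm1; apply/ltW.
    by rewrite ltNge; apply/negP => /gm/eqP; apply/negP.
  exists (BMultinom mk); first by rewrite !inE; exists m.
  by apply/negP; rewrite !inE => -[m' m'm /negP]; apply; rewrite gm.
have [a [ak fa]] := IHN _ SgN Lg kg.
exists (fun j => a j + (if j == i then q else 0)); split.
  by move=> j; apply: ordgeD => //; case: ifP.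
rewrite (_ : f - _ = f - q * F i - \sum_j a j * F j) //.
under eq_bigr do rewrite mulrDl.
rewrite big_split /= (_ : \sum_(j < s) (if j == i then q else 0) * F j = q * F i).
  by rewrite opprD addrA addrAC.
rewrite (bigD1 i) //= eqxx big1 ?addr0 // => j /negPf ->.
by rewrite mul0r.
Qed.

(** Iterating [division_step] pushes the remainder to arbitrarily high order, and the multipliers
    form a convergent series because their orders tend to infinity. *)
Lemma division L (s : nat) (F : 'I_s -> A) (mu : 'I_s -> mon) (c k : nat) f :
  ideal L -> (forall i, L (F i)) -> (forall i, is_lead (F i) (mu i)) ->
  (forall m, lead_mon L m -> exists i, mpoly.lem (mu i) m) ->
  (forall i, (mdeg (mu i) <= c)%N) -> L f -> ordge k f ->
  exists a : 'I_s -> A, (forall i, ordge (k - c) (a i)) /\ f = \sum_i a i * F i.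
Proof.
move=> iL LF lF basis muc Lf kf.
have /choice[q Hq] : forall p : nat * A, exists a : 'I_s -> A,
    L p.2 -> ordge p.1 p.2 -> (forall i, ordge (p.1 - c) (a i)) /\
    ordge p.1.+1 (p.2 - \sum_i a i * F i).
  move=> [l g] /=; have [[Lg lg]|ng] := pselect (L g /\ ordge l g).
    by have [a Ha] := division_step iL LF lF basis muc Lg lg; exists a.
  by exists (fun=> 0) => Lg lg; case: ng.
pose fix g t := if t is u.+1 then g u - \sum_i q ((k + u)%N, g u) i * F i else f.
have gL t : L (g t) /\ ordge (k + t) (g t).
  elim: t => [|t [Lg kg]]; first by rewrite addn0.
  have [_] := Hq ((k + t)%N, g t) Lg kg; rewrite addnS; split=> //=.
  apply: idealB => //; apply: ideal_sum => // i _.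
  by case: iL => _ _; apply.
pose a t i := q ((k + t)%N, g t) i.
have ak t i : ordge (k + t - c) (a t i).
  by have [Lg kg] := gL t; have [] := Hq ((k + t)%N, g t) Lg kg => + _; apply.
(* For [t >= mdeg m + c + 1] the order [k + t - c] of [a t i] exceeds [mdeg m], so this finite sum
   is the full coefficient. *)
pose b i : A := PowSer (fun m => \sum_(t < mdeg m + c + 1) coefps (a t i) m).
exists b; split=> [i m mk|].
  by rewrite /= big1 // => t _; apply: ak; move: mk; lia.
have gT T : f = g T + \sum_i (\sum_(t < T) a t i) * F i.
  elim: T => [|T IHT].
    by rewrite /= big1 ?addr0 // => i _; rewrite big_ord0 mul0r.
  rewrite (eq_bigr (fun i => (\sum_(t < T) a t i) * F i + a T i * F i)).
    by rewrite big_split /= addrACA addNr addr0.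
  by move=> i _; rewrite big_ord_recr mulrDl.
apply: powserP => m; pose T := (mdeg m + c + 1)%N.
have bS i : ordge (mdeg m).+1 (b i - \sum_(t < T) a t i).
  move=> m' m'm; rewrite coefpsB coefps_sum /= -!(big_mkord xpredT (fun t => coefps (a t i) m')).
  have le : (mdeg m' + c + 1 <= T)%N by rewrite !leq_add2r.
  rewrite [X in _ - X](big_cat_nat _ le) //= [X in _ - (_ + X)]big_nat_cond.
  rewrite [X in _ - (_ + X)]big1 ?addr0 ?subrr // => t /andP[/andP[lt _] _].
  by apply: ak; lia.
rewrite {1}(gT T) /= (proj2 (gL T)) ?add0r; last by rewrite /T; lia.
apply/eqP; rewrite eq_sym -subr_eq0 -coefpsB -sumrB.
under eq_bigr do rewrite -mulrBl mulrC.
by apply/eqP; apply: (ordge_sum (k := (mdeg m).+1)) => // i _; apply: ordgeMl.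
Qed.

Lemma lead_basis L : ideal L -> exists s (F : 'I_s -> A) (mu : 'I_s -> mon) c,
  [/\ forall i, L (F i), forall i, is_lead (F i) (mu i),
      forall m, lead_mon L m -> exists i, mpoly.lem (mu i) m
    & forall i, (mdeg (mu i) <= c)%N].
Proof.
move=> iL; have [r [rL Hr]] := dickson (lead_mon L).
have /choice[F HF] : forall i : 'I_(size r), exists f, L f /\ is_lead f (tnth (in_tuple r) i).
  by move=> i; have [f Lf lf] := rL _ (mem_tnth i (in_tuple r)); exists f.
exists (size r), F, (tnth (in_tuple r)), (\max_(m <- r) mdeg m); split=> [i|i|m /Hr[e er em]|i].
- by have [] := HF i.
- by have [] := HF i.
- by have /tnthP[i ei] := (er : e \in in_tuple r); exists i; rewrite -ei.
- by apply: leq_bigmax_seq => //; apply: (mem_tnth i (in_tuple r)).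
Qed.

(** The constant is the largest leading degree in a finite standard basis; the elements of [L] of
    order [k] lie in the product of [L] with the power [k - c] of the maximal ideal. *)
Lemma artin_rees L : ideal L -> exists s (F : 'I_s -> A) c,
  (forall i, L (F i)) /\ forall k f, L f -> ordge k f ->
  exists a : 'I_s -> A, (forall i, ordge (k - c) (a i)) /\ f = \sum_i a i * F i.
Proof.
move=> iL; have [s [F [mu [c [LF lF basis muc]]]]] := lead_basis iL.
by exists s, F, c; split=> // k f Lf kf; apply: (division iL LF lF basis muc Lf kf).
Qed.

Lemma ideal_fg L : ideal L -> exists s (F : 'I_s -> A), L = ideal_gen (range F).
Proof.
move=> iL; have [s [F [c [LF HF]]]] := artin_rees iL; exists s, F.
rewrite ideal_gen_span; apply/seteqP; split=> [f Lf|_ [a _ <-]].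
  by have [|a [_ ->]] := HF 0%N f Lf; [|exists a].
by apply: ideal_sum => // i _; case: iL => _ _; apply.
Qed.

(** A standard basis of [E] also divides every element of [L], with remainder zero. *)
Lemma lead_mon_inj E L : ideal E -> ideal L -> E `<=` L ->
  (forall m, lead_mon L m -> lead_mon E m) -> L `<=` E.
Proof.
move=> iE iL EL leadE f Lf; have [s [F [mu [c [EF lF basis muc]]]]] := lead_basis iE.
have [|||a [_ ->]] := @division L s F mu c 0 f iL _ lF _ muc Lf.
- by move=> i; apply: EL.
- by move=> m /leadE/basis.
- by [].
by apply: ideal_sum => // i _; case: iE => _ _; apply.
Qed.

(** The Noetherian property: without a maximal element there is a strictly increasing chain, but its
    union is finitely generated and thus already reached at a finite stage. *)
Lemma ideal_maximal (Phi : set A -> Prop) :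
  (exists2 J, ideal J & Phi J) ->
  exists J, [/\ ideal J, Phi J & forall L, ideal L -> Phi L -> J `<=` L -> L `<=` J].
Proof.
move=> [J0 iJ0 PJ0]; apply: contrapT => /forallNP nmax.
have /choice[nx Hnx] : forall J, exists L, ideal J -> Phi J ->
    [/\ ideal L, Phi L, J `<=` L & ~ (L `<=` J)].
  move=> J; have [[iJ PJ]|nJ] := pselect (ideal J /\ Phi J); last first.
    by exists J => iJ PJ; case: nJ.
  apply: contrapT => /forallNP nL; apply: (nmax J); split=> // L iL PL JL.
  by apply: contrapT => LJ; apply: (nL L).
pose fix c t := if t is u.+1 then nx (c u) else J0.
have cP t : ideal (c t) /\ Phi (c t).
  by elim: t => [//|t [ic Pc]]; have [] := Hnx _ ic Pc.
have cS t : c t `<=` c t.+1 by have [ic Pc] := cP t; have [] := Hnx _ ic Pc.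
have cle t u : (t <= u)%N -> c t `<=` c u.
  elim: u => [|u IHu]; first by rewrite leqn0 => /eqP->.
  by rewrite leq_eqVlt => /predU1P[->//|/IHu tu]; apply: subset_trans (cS u).
pose U : set A := [set f | exists t, c t f].
have iU : ideal U.
  split.
  - by exists 0%N; have [[]] := cP 0%N.
  - move=> f g [t ft] [u gu]; exists (maxn t u); have [[_ cD _] _] := cP (maxn t u).
    by apply: cD; [apply: cle ft|apply: cle gu]; rewrite ?leq_maxl ?leq_maxr.
  - by move=> f g [t gt]; exists t; have [[_ _ cM] _] := cP t; apply: cM.
have [s [F UE]] := ideal_fg iU.
have /choice[t Ht] : forall i, exists t, c t (F i).
  by move=> i; have : U (F i) by rewrite UE; apply: sub_ideal_gen; exists i.
pose T := \max_i t i.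
have [iT PT] := cP T; have [_ _ _] := Hnx _ iT PT; apply => f fT.
have : U f by exists T.+1.
rewrite UE; apply: ideal_gen_sub => // _ [i _ <-].
by apply: cle (Ht i); apply: leq_bigmax.
Qed.

End LeadingMonomials.

(** * The Hilbert-Samuel function *)

Section VectorSpaces.
Variable K : fieldType.

(** A subspace of maximal dimension inside [P] must exhaust [P], since a missing vector could be
    adjoined. *)
Lemma vspace_of_pred (vT : vectType K) (P : vT -> Prop) :
  P 0 -> (forall a u v, P u -> P v -> P (a *: u + v)) ->
  exists U : {vspace vT}, forall v, v \in U <-> P v.
Proof.
move=> P0 Plin; pose sub (U : {vspace vT}) := forall v, v \in U -> P v.
have sub0 : sub 0%VS by move=> v; rewrite memv0 => /eqP->.
have bound d : `[< exists2 U, sub U & \dim U = d >] -> (d <= dim vT)%N.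
  by move=> /asboolP[U _ <-]; rewrite -dimvf dimvS ?subvf.
have ex : exists d, `[< exists2 U, sub U & \dim U = d >].
  by exists 0%N; apply/asboolP; exists 0%VS; rewrite ?dimv0.
case: (ex_maxnP ex bound) => d /asboolP[U subU <-] maxU; exists U => v.
split=> [/subU//|Pv]; apply: contrapT => /negP vU.
have : sub (U + <[v]>)%VS.
  move=> _ /memv_addP[u uU [_ /vlineP[a ->] ->]].
  by rewrite addrC; apply: Plin => //; apply: subU.
move=> subU'; have := maxU (\dim (U + <[v]>)) (introT (asboolP _) (ex_intro2 _ _ _ subU' erefl)).
move=> le; have : (U + <[v]> <= U)%VS.
  by rewrite -(geq_leqif (dimv_leqif_sup (addvSl U <[v]>))).
by rewrite subv_add subvv /= -memvE (negPf vU).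
Qed.

Lemma lfun_of_linear (aT rT : vectType K) (f : aT -> rT) : linear f ->
  exists g : 'Hom(aT, rT), g =1 f.
Proof.
move=> lf; pose fM := GRing.isLinear.Build K aT rT _ f lf.
pose fL : {linear aT -> rT} := HB.pack f fM.
by exists (linfun fL) => v; rewrite lfunE.
Qed.

(** Rank-nullity for [f] and for its restriction to [D]: both have the same kernel, and the image of
    [D] is the intersection of [limg f] with [U]. *)
Lemma dim_preim (vT rT : vectType K) (f : 'Hom(vT, rT)) (U : {vspace rT}) (D : {vspace vT}) :
  (forall v, v \in D <-> f v \in U) ->
  (\dim (limg f + U) + \dim D = \dim {:vT} + \dim U)%N.
Proof.
move=> DU; have <- := limg_ker_dim f D; have <- := limg_ker_dim f fullv.
have -> : (f @: D = limg f :&: U)%VS.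
  apply/vspaceP => w; apply/idP/idP => [/memv_imgP[v vD ->]|].
    by rewrite memv_cap memv_img ?memvf //; apply/DU.
  rewrite memv_cap => /andP[/memv_imgP[v _ ->]] /DU vD.
  exact: memv_img.
have -> : (D :&: lker f = fullv :&: lker f)%VS.
  rewrite capfv; apply/vspaceP => v; rewrite memv_cap.
  apply/andP/idP => [[]//|vf]; split=> //; apply/DU.
  by move: vf; rewrite memv_ker => /eqP ->; apply: mem0v.
by rewrite addnCA dimv_sum_cap addnA.
Qed.

End VectorSpaces.

Section HilbertSamuel.
Variables (n : nat) (K : fieldType).
Local Notation mon := (multinom n).
Local Notation A := (powser n K).
Implicit Types (f g : A) (m : mon) (J L E : set A) (k : nat).

Definition std_set k J : {set bmultinom n k.+1} :=
  [set m : bmultinom n k.+1 | `[< ~ lead_mon J (bmnm m) >]]%SET.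

(* The length of A/(J + m^(k+1)), as the number of standard monomials. *)
Definition hilb J k : nat := #|std_set k J|.

Lemma mem_std_set k J (m : bmultinom n k.+1) :
  reflect (~ lead_mon J (bmnm m)) (m \in std_set k J).
Proof. by rewrite finset.in_set; apply: asboolP. Qed.

Lemma hilb_le k l J L :
  (forall m, (mdeg m <= k)%N -> ~ lead_mon J m -> (mdeg m <= l)%N /\ ~ lead_mon L m) ->
  (hilb J k <= hilb L l)%N.
Proof.
move=> H.
have d0 : (mdeg (mnm0 : mon) < l.+1)%N by rewrite mdeg0.
pose phi (m : bmultinom n k.+1) : bmultinom n l.+1 := insubd (BMultinom d0) (bmnm m).
have phiE (m : bmultinom n k.+1) : m \in std_set k J -> bmnm (phi m) = bmnm m.
  move=> /mem_std_set sm; rewrite /phi val_insubd.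
  by have [|mk _] := H (bmnm m) _ sm; [by rewrite -ltnS bmdeg|rewrite ltnS mk].
rewrite /hilb -(card_in_imset (f := phi) (D := std_set k J)).
  apply/subset_leq_card/fintype.subsetP => _ /imsetP[m ms ->].
  apply/mem_std_set; rewrite phiE //; move/mem_std_set: ms => sm.
  by have [|] := H (bmnm m) _ sm; first by rewrite -ltnS bmdeg.
by move=> m1 m2 s1 s2 /(congr1 (@bmnm _ _)); rewrite !phiE // => /val_inj.
Qed.

Lemma hilb_sub k J L : J `<=` L -> (hilb L k <= hilb J k)%N.
Proof.
by move=> JL; apply: hilb_le => m mk nL; split=> // -[f /JL Lf fm]; apply: nL; exists f.
Qed.

Section Truncation.
Variable k : nat.
Local Notation B := (bmultinom n k.+1).
Local Notation V := {ffun B -> K^o}.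

Definition trunc f : V := [ffun m : B => coefps f (bmnm m)].

Definition lift_trunc (v : V) : A :=
  PowSer (fun m => if insub m is Some b then v b else 0).

Lemma lift_truncK : cancel lift_trunc trunc.
Proof. by move=> v; apply/ffunP => m; rewrite ffunE /= valK. Qed.

Lemma lift_trunc_linear a u v :
  lift_trunc (a *: u + v) = cmon a mnm0 * lift_trunc u + lift_trunc v.
Proof.
apply: powserP => m; rewrite coefpsD coefps_scale /=; case: insubP => [b _ _|_]; last by rewrite mulr0 addr0.
by rewrite !ffunE.
Qed.

Lemma truncE f g : trunc f = trunc g <-> ordge k.+1 (f - g).
Proof.
split=> [/ffunP fg m mk|fg].
  by have := fg (BMultinom mk); rewrite !ffunE coefpsB /= => ->; rewrite subrr.
apply/ffunP => m; rewrite !ffunE; apply/eqP; rewrite -subr_eq0 -coefpsB.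
by rewrite fg // bmdeg.
Qed.

Lemma ordge_lift_trunc f : ordge k.+1 (f - lift_trunc (trunc f)).
Proof. by apply/truncE; rewrite lift_truncK. Qed.

Definition trunc_image J (v : V) : Prop := exists2 f, J f & trunc f = v.

Lemma trunc_vspace J : ideal J -> exists U : {vspace V}, forall v, v \in U <-> trunc_image J v.
Proof.
move=> [J0 JD JM]; apply: vspace_of_pred.
  by exists 0 => //; apply/ffunP => m; rewrite !ffunE.
move=> a _ _ [f Jf <-] [g Jg <-]; exists (cmon a mnm0 * f + g); first by apply/JD/Jg/JM.
by apply/ffunP => m; rewrite !ffunE coefpsD coefps_scale.
Qed.

Lemma trunc_reduce J (v : V) : ideal J -> exists2 f, J f &
  forall m : B, lead_mon J (bmnm m) -> v m = coefps f (bmnm m).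
Proof.
(* The smallest offending coefficient is cancelled first. This changes only larger ones among those
   at leading monomials, so [bad], the upward closure of the offending monomials, shrinks
   strictly. *)
move=> iJ; pose bad (v : V) := [set m : B |
  `[< exists m' : B, [/\ (bmnm m' <= bmnm m)%O, lead_mon J (bmnm m') & v m' != 0] >]]%SET.
move: {2}#|bad v| (leqnn #|bad v|) => N; elim: N v => [|N IHN] v vN.
  exists 0; first by case: iJ.
  move=> m lm; apply: contrapT => /eqP vm.
  move: vN; rewrite leqn0 cards_eq0 => /eqP /setP /(_ m).
  by rewrite finset.in_set0 => /negP; apply; rewrite finset.in_set; apply/asboolP; exists m.
have [ex|nex] := pselect (exists m : B, lead_mon J (bmnm m) /\ v m != 0); last first.
  exists 0; first by case: iJ.
  by move=> m lm; apply: contrapT => /eqP vm; apply: nex; exists m.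
have [m0 [[lm0 vm0] minm0]] : exists m0 : B, (lead_mon J (bmnm m0) /\ v m0 != 0) /\
    forall m : B, lead_mon J (bmnm m) -> (bmnm m < bmnm m0)%O -> v m = 0.
  case: ex => m1 [lm1 vm1].
  pose S := [pred m : B | `[< lead_mon J (bmnm m) >] && (v m != 0)].
  have S1 : S m1 by apply/andP; split=> //; apply/asboolP.
  case: (Order.TotalTheory.arg_minP (fun m : B => bmnm m) S1).
  move=> m0 /andP[/asboolP lm0 vm0] minm0.
  exists m0; split=> // m lm mm0; apply: contrapT => /eqP vm.
  have : S m by apply/andP; split=> //; apply/asboolP.
  by move/minm0; rewrite leNgt mm0.
have [g Jg [gm0 gl]] := lm0.
have [_ JD JM] := iJ.
pose c := v m0 / coefps g (bmnm m0); pose q : A := cmon c mnm0 * g.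
have Jq : J q by apply: JM.
pose w : V := v - trunc q.
have wE (m : B) : w m = v m - coefps q (bmnm m) by rewrite !ffunE.
have wm (m : B) : (bmnm m <= bmnm m0)%O -> lead_mon J (bmnm m) -> w m = 0.
  rewrite wE coefps_scale le_eqVlt => /predU1P[/val_inj -> _|mm0 lm].
    by rewrite divfK // subrr.
  by rewrite minm0 // gl // mulr0 subrr.
have wN : (#|bad w| <= N)%N.
  rewrite -ltnS; apply: leq_trans vN; apply/proper_card/properP; split.
    apply/fintype.subsetP => m; rewrite !finset.in_set => /asboolP[m' [m'm lm' wm']].
    apply/asboolP; exists m0; split=> //; apply: le_trans m'm; apply/ltW.
    by rewrite ltNge; apply/negP => /wm/(_ lm')/eqP; apply/negP.
  exists m0; rewrite finset.in_set; first by apply/asboolP; exists m0.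
  by apply/asboolP => -[m' [m'm lm' /negP]]; apply; rewrite wm.
have [f Jf fw] := IHN w wN.
exists (f + q); first exact: JD.
move=> m lm; rewrite -[LHS](subrK (coefps q (bmnm m))) -wE fw //.
Qed.

(** The vectors supported on standard monomials form a complement of the image of [J]: the leading
    monomial of a nonzero truncation from [J] is not standard, and [trunc_reduce] gives the
    spanning. *)
Lemma hilb_dim J (U : {vspace V}) : ideal J ->
  (forall v, v \in U <-> trunc_image J v) -> (hilb J k + \dim U = \dim {:V})%N.
Proof.
move=> iJ UJ; pose S := ~: std_set k J.
have SP (m : B) : reflect (lead_mon J (bmnm m)) (m \in S).
  rewrite finset.in_setC; apply: (iffP negP) => [|lm /mem_std_set //].
  by move=> ns; apply: contrapT => nl; apply/ns/mem_std_set.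
pose r (v : V) : {ffun 'I_#|S| -> K^o} := [ffun i => v (enum_val i)].
have [R RE] : exists g : 'Hom(V, _), g =1 r.
  by apply: lfun_of_linear => a u v; apply/ffunP => i; rewrite !ffunE.
have Rfull : limg R = fullv.
  apply/vspaceP => w; rewrite memvf; apply/memv_imgP.
  exists [ffun m => \sum_(i | enum_val i == m) w i]; rewrite ?memvf // RE.
  apply/ffunP => i; rewrite !ffunE (big_pred1 i) // => j.
  by rewrite /= (inj_eq enum_val_inj).
have UR : (U :&: lker R = 0)%VS.
  apply/eqP; rewrite -subv0; apply/subvP => v; rewrite memv_cap memv0 memv_ker.
  move=> /andP[/UJ[f Jf <-] /eqP fR]; apply/eqP.
  have [f0|[m lfm]] : lift_trunc (trunc f) = 0 \/ exists m, is_lead (lift_trunc (trunc f)) m.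
    have [->|/eqP/is_lead_ex] := eqVneq (lift_trunc (trunc f)) 0; by [left|right].
    by rewrite -[LHS]lift_truncK f0; apply/ffunP => m; rewrite !ffunE.
  have mk : (mdeg m < k.+1)%N.
    rewrite ltnNge; apply/negP => km; have [/eqP + _] := lfm; apply => /=.
    by case: insubP => // b; rewrite ltnNge km.
  have lm : lead_mon J m.
    exists f => //; split.
      have := lfm.1; have := ordge_lift_trunc f mk.
      by rewrite coefpsB => /subr0_eq ->.
    move=> m' m'm; have := lfm.2 _ m'm; have m'k : (mdeg m' < k.+1)%N.
      by apply: leq_ltn_trans mk; apply/lemc_mdeg/ltW.
    by have := ordge_lift_trunc f m'k; rewrite coefpsB => /subr0_eq ->.
  have mS : BMultinom mk \in S by apply/SP.
  have := congr1 (fun w : {ffun 'I_#|S| -> K^o} => w (enum_rank_in mS (BMultinom mk))) fR.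
  rewrite RE !ffunE enum_rankK_in //= => fm.
  have := lfm.1; have := ordge_lift_trunc f mk.
  by rewrite coefpsB => /subr0_eq <-; rewrite fm eqxx.
have URf : (U + lker R = fullv)%VS.
  apply/vspaceP => v; rewrite memvf; have [f Jf fv] := trunc_reduce v iJ.
  apply/memv_addP; exists (trunc f); first by apply/UJ; exists f.
  exists (v - trunc f); last by rewrite addrC subrK.
  rewrite memv_ker RE; apply/eqP/ffunP => i; rewrite !ffunE fv ?subrr //.
  by apply/SP/enum_valP.
have dk : (\dim (lker R) + #|S| = \dim {:V})%N.
  have := limg_ker_dim R fullv; rewrite capfv Rfull dimvf => <-; congr (_ + _)%N.
  by rewrite /dim /= card_ord muln1.
have e : (\dim {:V} = \dim U + \dim (lker R))%N.
  by rewrite -dimv_sum_cap URf UR dimv0 addn0.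
have cS : (#|S| + hilb J k = \dim {:V})%N.
  rewrite dimvf /dim /= muln1 /S /hilb addnC cardsC; by rewrite ?cardsT.
apply/eqP; rewrite -(eqn_add2r #|S|) addnC addnA cS addnC.
by rewrite e -addnA dk -e addnC.
Qed.

(** The kernel of multiplication by [a] from A to A/(J + m^(k+1)). It depends on the ambient [k]
    through the error term [w]. *)
Definition colon J (a : A) : set A :=
  [set f | exists2 w, ordge k.+1 w & J (a * f + w)].

Lemma colon_ideal J a : ideal J -> ideal (colon J a).
Proof.
move=> [J0 JD JM]; split.
- by exists 0 => //; rewrite mulr0 addr0.
- move=> f g [v kv Jf] [w kw Jg]; exists (v + w); first exact: ordgeD.
  by rewrite mulrDr addrACA; apply: JD.
- move=> f g [w kw Jg]; exists (f * w); first exact: ordgeMl.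
  by rewrite mulrCA -mulrDr; apply: JM.
Qed.

(* Exactness of 0 -> A/(J : a) -> A/J -> A/(J + (a)) -> 0, truncated at order k. *)
Lemma hilb_colon J a : ideal J ->
  hilb J k = (hilb (ideal_add J (ideal_gen [set a])) k + hilb (colon J a) k)%N.
Proof.
move=> iJ; set L := ideal_add _ _.
have iL : ideal L by apply: ideal_add_ideal iJ (ideal_gen_ideal _).
have iC := colon_ideal a iJ.
have [U UE] := trunc_vspace iJ; have [W WE] := trunc_vspace iL.
have [D DE] := trunc_vspace iC.
have hU := hilb_dim iJ UE; have hW := hilb_dim iL WE; have hD := hilb_dim iC DE.
pose mula (v : V) : V := trunc (a * lift_trunc v).
have mula_trunc f : mula (trunc f) = trunc (a * f).
  apply/truncE; rewrite -mulrBr; apply: ordgeMl.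
  by have := ordgeB (@ordge0 n K k.+1) (ordge_lift_trunc f); rewrite sub0r opprB.
have [M ME] : exists g : 'Hom(V, V), g =1 mula.
  apply: lfun_of_linear => c u v; rewrite /mula lift_trunc_linear mulrDr mulrCA.
  by apply/ffunP => m; rewrite !ffunE coefpsD coefps_scale.
(* In truncated form the colon ideal is the preimage of [J] under multiplication by [a], while
   [limg M + U] below is the truncation of [L]; [dim_preim] then compares the four dimensions. *)
have DM v : v \in D <-> M v \in U.
  rewrite DE UE ME -{2}(lift_truncK v) mula_trunc; split.
    move=> [f [w kw Jf] <-]; exists (a * f + w) => //.
    rewrite -mula_trunc lift_truncK mula_trunc; apply/truncE.
    by rewrite addrAC subrr add0r.
  move=> [f Jf /truncE fv]; exists (lift_trunc v); last exact: lift_truncK.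
  by exists (f - a * lift_trunc v) => //; rewrite addrC subrK.
have := dim_preim DM; have -> : (limg M + U = W)%VS.
  apply/vspaceP => v; apply/idP/idP.
    move=> /memv_addP[_ /memv_imgP[u _ ->] [_ /UE[f Jf <-] ->]].
    apply/WE; exists (f + lift_trunc u * a).
      exists f => //; exists (lift_trunc u * a) => //.
      by rewrite ideal_gen1E; exists (lift_trunc u).
    apply/ffunP => m; rewrite !ffunE ME ffunE addrC [lift_trunc u * a]mulrC.
    by [].
  move=> /WE[g [f Jf [b]]]; rewrite ideal_gen1E => -[c _ <-] <- <-.
  apply/memv_addP; exists (M (trunc c)); first by apply: memv_img; rewrite memvf.
  exists (trunc f); first by apply/UE; exists f.
  by apply/ffunP => m; rewrite ME mula_trunc !ffunE [a * c]mulrC addrC.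
by move: hU hW hD; rewrite /reverse_coercion; lia.
Qed.

End Truncation.
End HilbertSamuel.

(** * Growth of the Hilbert-Samuel function *)

Section Counting.
Variables (n : nat) (K : fieldType).
Local Notation mon := (multinom n).
Local Notation A := (powser n K).
Implicit Types (m u : mon) (J L E : set A) (k d : nat) (T : {set 'I_n}).

(* [h k = O(k^(d - 1))]; for [d = 0] this says that [h k = 0] for large [k]. *)
Definition small d (h : nat -> nat) : Prop :=
  exists C, forall k, (h k * k.+1 <= C * k.+1 ^ d)%N.

(** Independence of the variables in [T] modulo the initial ideal, tested only up to degree [k]; the
    cutoff makes it a first-order condition. *)
Definition free_on T k J : Prop := forall m,
  (forall i, i \notin T -> m i = 0%N) -> (mdeg m <= k)%N -> ~ lead_mon J m.

Lemma leq_mdeg m i : (m i <= mdeg m)%N.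
Proof. by rewrite mdegE (bigD1 i) //= leq_addr. Qed.

Lemma leq_wexp2r a b e : (a <= b -> a ^ e <= b ^ e)%N.
Proof. by case: e => [//|e] ab; rewrite leq_exp2r. Qed.

Lemma exists_subset_card (X : finType) (S : {set X}) d : (d <= #|S|)%N ->
  exists2 T : {set X}, T \subset S & #|T| = d.
Proof.
move=> dS; exists [set x in take d (enum S)]%SET.
  by apply/fintype.subsetP => x; rewrite finset.in_set => /mem_take; rewrite mem_enum.
rewrite cardsE (card_uniqP _) ?size_take -?cardE.
  by move: dS; rewrite leq_eqVlt => /predU1P[->|->//]; rewrite ltnn.
by apply: take_uniq; apply: enum_uniq.
Qed.

Lemma hilb_not_free J d k N : ideal J ->
  (forall T, #|T| = d -> ~ free_on T k J) ->
  (hilb J N * N.+1 <= k.+1 ^ n * N.+1 ^ d)%N.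
Proof.
move=> iJ nfree.
pose big (m : bmultinom n N.+1) := [set i : 'I_n | (k <= bmnm m i)%N]%SET.
have big_card (m : bmultinom n N.+1) : m \in std_set N J -> (#|big m| < d)%N.
  move=> /mem_std_set sm; rewrite ltnNge; apply/negP => /exists_subset_card[T Tbig Td].
  apply: (nfree T Td) => m' m'T m'k lm'; apply: sm; apply: lead_mon_le lm' => //.
  apply/mnm_lepP => i; have [iT|/m'T->//] := boolP (i \in T).
  apply: leq_trans (leq_trans (leq_mdeg _ _) m'k) _.
  by have /(_ i iT) := fintype.subsetP Tbig; rewrite finset.in_set.
case: d big_card {nfree} => [big_card|d big_card].
  rewrite /hilb (_ : std_set N J = finset.set0) ?cards0 //; apply/setP => m.
  by rewrite finset.in_set0; apply/negP => /big_card.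
rewrite expnSr mulnA leq_mul2r /=.
(* Exponents capped at [k] take [k.+1 ^ n] values; standard monomials are counted class by class. *)
pose cap (m : bmultinom n N.+1) : {ffun 'I_n -> 'I_k.+1} := [ffun i => inord (minn (bmnm m i) k)].
have capE (m : bmultinom n N.+1) i : (cap m i == k :> nat) = (k <= bmnm m i)%N.
  rewrite ffunE inordK ?ltnS ?geq_minr //; apply/eqP/idP => [<-|/minn_idPr//].
  exact: geq_minl.
rewrite /hilb -sum1_card (partition_big cap predT) //=.
apply: (@leq_trans (\sum_(c : {ffun 'I_n -> 'I_k.+1}) N.+1 ^ d)%N); last first.
  by rewrite sum_nat_const card_ffun !card_ord.
apply: leq_sum => c _; rewrite sum1dep_card.
set F := finset _; have [->|/set0Pn[m0]] := eqVneq F finset.set0; first by rewrite cards0.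
rewrite finset.in_set => /andP[sm0 /eqP cm0].
(* Inside a class the exponents outside [Tc] are below [k], hence determined by [c]; only those on
   [Tc] vary. *)
pose Tc := [set i : 'I_n | c i == k :> nat]%SET.
have Tcd : (#|Tc| <= d)%N.
  rewrite -ltnS; apply: leq_ltn_trans (big_card _ sm0); apply: subset_leq_card.
  by apply/fintype.subsetP => i; rewrite !finset.in_set -cm0 capE.
apply: leq_trans (_ : (N.+1 ^ #|Tc| <= _)%N); last by rewrite leq_pexp2l.
pose phi (m : bmultinom n N.+1) : {ffun 'I_n -> 'I_N.+1} :=
  [ffun i => if i \in Tc then inord (bmnm m i) else ord0].
have le (m : bmultinom n N.+1) i : (bmnm m i < N.+1)%N.
  by apply: leq_ltn_trans (leq_mdeg _ _) (bmdeg m).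
rewrite -(card_in_imset (f := phi) (D := F)).
  have := card_pffun_on (ord0 : 'I_N.+1) (mem Tc) (mem predT); rewrite card_ord => <-.
  apply/subset_leq_card/fintype.subsetP => _ /imsetP[m _ ->].
  apply/pffun_onP; split=> [|//].
  apply/fintype.subsetP => i; rewrite inE ffunE; case: ifP => //.
move=> m1 m2; rewrite !finset.in_set => /andP[_ /eqP c1] /andP[_ /eqP c2] /ffunP e.
apply/val_inj/mnmP => i; have [iT|iT] := boolP (i \in Tc).
  by have := e i; rewrite !ffunE iT => /(congr1 val); rewrite /= !inordK.
have := congr1 (fun c : {ffun 'I_n -> 'I_k.+1} => val (c i)) (etrans c1 (esym c2)).
have H (m : bmultinom n N.+1) : cap m = c -> minn (bmnm m i) k = bmnm m i.
  move=> cm; apply/minn_idPl; rewrite leqNgt; apply: contra iT => km.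
  by rewrite finset.in_set -cm capE ltnW.
by rewrite !ffunE /= !inordK ?ltnS ?geq_minr // !H.
Qed.

(** The monomials on [T] with all exponents at most [q] have degree at most [k] and are all
    standard. *)
Lemma free_hilb J T k q : free_on T k J -> (q * #|T| <= k)%N -> (q.+1 ^ #|T| <= hilb J k)%N.
Proof.
move=> fT qk; have := card_pffun_on (ord0 : 'I_q.+1) (mem T) (mem predT); rewrite card_ord => <-.
set D := mem _.
pose mon_of (f : {ffun 'I_n -> 'I_q.+1}) : mon := Multinom [tuple (f i : nat) | i < n].
have monE f i : mon_of f i = f i by rewrite multinomE tnth_mktuple.
have suppT f i : f \in pffun_on ord0 (mem T) (mem predT) -> i \notin T -> mon_of f i = 0%N.
  move=> /pffun_onP[/fintype.subsetP fT' _] iT; rewrite monE; apply/eqP.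
  by apply: contraNT iT => fi; apply: fT'.
have degT f : f \in pffun_on ord0 (mem T) (mem predT) -> (mdeg (mon_of f) < k.+1)%N.
  move=> fP; rewrite ltnS; apply: leq_trans qk; rewrite mdegE (bigID (mem T)) /=.
  rewrite [X in (_ + X)%N]big1 ?addn0 => [|i]; last exact: suppT.
  rewrite mulnC -sum_nat_const; apply: leq_sum => i _; rewrite monE.
  by rewrite -ltnS.
have d0 : (mdeg (mnm0 : mon) < k.+1)%N by rewrite mdeg0.
pose phi f : bmultinom n k.+1 := insubd (BMultinom d0) (mon_of f).
have phiE f : f \in pffun_on ord0 (mem T) (mem predT) -> bmnm (phi f) = mon_of f.
  by move=> /degT fk; rewrite /phi val_insubd fk.
rewrite -(card_in_imset (f := phi) (D := D)).
  apply/subset_leq_card/fintype.subsetP => _ /imsetP[f fD ->].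
  apply/mem_std_set; rewrite phiE //; apply: fT; last exact: degT.
  by move=> i; apply: suppT.
move=> f g fD gD /(congr1 (@bmnm _ _)); rewrite !phiE // => e.
by apply/ffunP => i; apply/val_inj; rewrite /= -!monE e.
Qed.

Lemma small_or_free d J : ideal J -> ~ small d (hilb J) ->
  forall k, exists2 T : {set 'I_n}, #|T| = d & free_on T k J.
Proof.
move=> iJ ns k; apply: contrapT => nT; apply: ns; exists (k.+1 ^ n)%N => N.
by apply: hilb_not_free => // T Td fT; apply: nT; exists T.
Qed.

Lemma free_not_small d J : (forall k, exists2 T : {set 'I_n}, #|T| = d & free_on T k J) ->
  ~ small d (hilb J).
Proof.
(* Since [k.+1 <= d.+1 * q.+1], smallness would bound [q.+1 ^ d * k.+1] by [q * q.+1 ^ d], although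
   [k.+1] exceeds [q]. *)
move=> fr [C HC]; pose q := (C * d.+1 ^ d)%N; pose k := (q * d.+1)%N.
have [T Td fT] := fr k.
have /(free_hilb fT) : (q * #|T| <= k)%N by rewrite Td leq_mul2l leqnSn orbT.
rewrite Td => le.
have : (q.+1 ^ d * k.+1 <= C * (d.+1 * q.+1) ^ d)%N.
  apply: leq_trans (leq_mul le (leqnn _)) (leq_trans (HC k) _).
  by rewrite leq_mul2l leq_wexp2r ?orbT // /k; lia.
rewrite expnMn mulnA mulnC leq_mul2r expn_eq0 /= leqNgt ltnS.
by rewrite -/q leq_pmulr.
Qed.

(** Summing the inequality along multiples of [c] makes [P] grow one degree faster than [Q]. *)
Lemma growth_step d c (P Q : nat -> nat) : (0 < c)%N ->
  (forall k q, (q * d <= k)%N -> (q.+1 ^ d <= Q k)%N) ->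
  (forall k, (c <= k)%N -> (Q k + P (k - c) <= P k)%N) -> ~ small d.+1 P.
Proof.
move=> c0 HQ HP [C HC].
have sumQ k j : (\sum_(j <= i < k) Q (i.+1 * c) <= P (k * c))%N.
  elim: k => [|k IHk]; first by rewrite big_geq.
  have [jk|kj] := leqP j k; last by rewrite big_geq.
  rewrite big_nat_recr //= addnC.
  apply: leq_trans (HP _ (leq_pmull _ (ltn0Sn _))).
  by rewrite leq_add2l mulSn addKn.
(* Only the upper half of the sum up to [k] is kept, where each term is at least [q.+1 ^ d]. [M]
   satisfies [k * c + 1 <= M * q.+1], and [q] exceeds [C * M ^ d.+1], so the lower bound beats the
   upper one. *)
pose M := (2 * d.+1 * c + 1)%N; pose q := (C * M ^ d.+1).+1; pose k := (2 * (q * d.+1))%N.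
have lo : (q * d.+1 * q.+1 ^ d <= P (k * c))%N.
  apply: leq_trans (sumQ k (q * d.+1)%N).
  rewrite -[X in (X * _ <= _)%N](_ : k - q * d.+1 = _)%N; last by rewrite /k; lia.
  rewrite -sum_nat_const_nat big_nat_cond [leqRHS]big_nat_cond.
  apply: leq_sum => i /andP[/andP[qi _] _]; apply: HQ.
  apply: leq_trans (_ : (i.+1 <= _)%N); last by rewrite leq_pmulr.
  apply: leqW; apply: leq_trans qi; by rewrite leq_mul2l leqnSn orbT.
have := HC (k * c)%N; rewrite leqNgt => /negP; apply.
apply: (@leq_ltn_trans (q * q.+1 ^ d.+1)%N).
  apply: (@leq_trans (C * (M * q.+1) ^ d.+1)%N).
    by rewrite leq_mul2l leq_wexp2r ?orbT // /k /M; nia.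
  by rewrite expnMn mulnA leq_mul2r leqnSn orbT.
apply: (@leq_trans (q * d.+1 * q.+1 ^ d * (k * c).+1)%N); last by rewrite leq_mul2r lo orbT.
have -> : (q * d.+1 * q.+1 ^ d * (k * c).+1 = q * q.+1 ^ d * (d.+1 * (k * c).+1))%N.
  by rewrite -!mulnA; congr (_ * _)%N; rewrite mulnCA.
rewrite expnSr mulnA ltn_pmul2l; first by rewrite /k; nia.
by rewrite muln_gt0 expn_gt0.
Qed.

Lemma small_step d (P Q : nat -> nat) : (P 0%N <= Q 0%N)%N ->
  (forall k, (P k.+1 <= Q k.+1 + P k)%N) -> small d Q -> small d.+1 P.
Proof.
move=> P0 PS [C HC].
have sumP k : (P k <= \sum_(i < k.+1) Q i)%N.
  elim: k => [|k IHk]; first by rewrite big_ord_recl big_ord0 addn0.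
  by rewrite big_ord_recr /= addnC (leq_trans (PS k)) // leq_add2l.
(* For [d = 0] the function [Q] vanishes from [C] on, so [P] is bounded. *)
case: d HC => [|d] HC.
  exists (\sum_(i < C) Q i)%N => k; rewrite expn1 leq_mul2r /=.
  apply: leq_trans (sumP k) _; rewrite -!(big_mkord xpredT Q).
  have Q0 i : (C <= i)%N -> Q i = 0%N.
    by move=> Ci; have := HC i; rewrite expn0 muln1; case: (Q i) => // x; lia.
  have [kC|Ck] := leqP k.+1 C.
    by rewrite [leqRHS](big_cat_nat _ kC) //= leq_addr.
  rewrite (big_cat_nat _ (ltnW Ck)) //= [X in (_ + X)%N]big_nat_cond.
  by rewrite [X in (_ + X)%N]big1 ?addn0 // => i /andP[/andP[/Q0]].
exists C => k; rewrite [in leqRHS]expnSr mulnA leq_mul2r /=.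
apply: leq_trans (sumP k) _; apply: (@leq_trans (\sum_(i < k.+1) C * k.+1 ^ d)%N).
  apply: leq_sum => i _; have := HC i; rewrite expnSr mulnA leq_mul2r /= => /leq_trans; apply.
  by rewrite leq_mul2l leq_wexp2r ?orbT // ltnW // ltnS.
by rewrite sum_nat_const card_ord mulnC expnSr mulnA.
Qed.

Lemma small_le d (P Q : nat -> nat) : (forall k, (P k <= Q k)%N) -> small d Q -> small d P.
Proof. by move=> PQ [C HC]; exists C => k; apply: leq_trans (HC k); rewrite leq_mul2r PQ orbT. Qed.

Lemma small_add d (P Q : nat -> nat) : small d P -> small d Q -> small d (fun k => P k + Q k)%N.
Proof.
by move=> [C HC] [D HD]; exists (C + D)%N => k; rewrite !mulnDl leq_add.
Qed.

End Counting.

(** * Dimension *)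

Section MaximalIdeal.
Variables (n : nat) (K : fieldType).
Local Notation mon := (multinom n).
Local Notation A := (powser n K).
Implicit Types (f g : A) (m u : mon) (J L E : set A) (k d : nat).

Lemma mdeg_gt0_max m f : (0 < mdeg m)%N -> is_lead f m -> maxps f.
Proof.
move=> m0 [_ fl]; apply: fl; apply: lt_mdeg_ltmc; by rewrite mdeg0.
Qed.

Lemma maxpsE f : maxps f <-> ordge 1 f.
Proof.
split=> [f0 m|]; last by apply; rewrite mdeg0.
by rewrite ltnS leqn0 mdeg_eq0 => /eqP ->.
Qed.

Lemma maxps_ideal : ideal (@maxps n K).
Proof.
rewrite (_ : @maxps n K = ordge 1); first exact: ordge_ideal.
by apply/seteqP; split=> f /maxpsE.
Qed.

Lemma ordge_prod k (a : 'I_k -> A) : (forall i, maxps (a i)) -> ordge k (\prod_(i < k) a i).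
Proof.
elim: k a => [|k IHk] a am; first by move=> m.
rewrite big_ord_recl; have := @ordgeM n K 1 k; rewrite add1n; apply.
  exact/maxpsE.
exact: IHk.
Qed.

Lemma ideal_exp_ordge k : ideal_exp (@maxps n K) k `<=` ordge k.
Proof.
apply: ideal_gen_sub; first exact: ordge_ideal.
by move=> _ [a am <-]; apply: ordge_prod.
Qed.

Lemma cmonD u m : cmon (1 : K) (mnm_add u m) = cmon 1 u * cmon 1 m.
Proof.
apply: powserP => x; rewrite coefps_cmonM mul1r /=.
have [ux|nux] := boolP (mpoly.lem u x).
  by rewrite -{1}(submK ux) [mnm_add _ u]addmC eqm_add2l.
by case: eqP nux => [->|//]; rewrite lem_addr.
Qed.

Lemma exists_divisor_mdeg k m : (k <= mdeg m)%N -> exists2 u, mpoly.lem u m & mdeg u = k.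
Proof.
move: {2}(mdeg m - k)%N (erefl (mdeg m - k)%N) => j; elim: j m => [|j IHj] m e km.
  by exists m; [exact: lepm_refl|lia].
have [i mi] : exists i, m i != 0%N.
  apply: contrapT => /forallNP mi; suff m0 : mdeg m = 0%N by move: e; rewrite m0.
  by rewrite mdegE big1 // => i _; apply/eqP; apply: contrapT => /negP/mi.
have um : mpoly.lem (mnm1 i) m by rewrite lep1mP.
have dm : (mdeg (mnm_sub m (mnm1 i)) = mdeg m - 1)%N.
  by rewrite -{2}(submK um) mdegD mdeg1 addnK.
have [||u uu du] := IHj (mnm_sub m (mnm1 i)); rewrite ?dm; try lia.
by exists u => //; apply: lepm_trans uu (lem_subr _ _).
Qed.

Lemma cmon_prod k u : mdeg u = k ->
  exists2 a : 'I_k -> A, (forall i, maxps (a i)) & cmon 1 u = \prod_(i < k) a i.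
Proof.
elim: k u => [|k IHk] u uk.
  have -> : u = mnm0 by apply/eqP; rewrite -mdeg_eq0 uk.
  exists (fun=> 0) => //; rewrite big_ord0; apply: powserP => m /=.
  by case: eqP.
have [i ui] : exists i, u i != 0%N.
  apply: contrapT => /forallNP ui; suff m0 : mdeg u = 0%N by move: uk; rewrite m0.
  by rewrite mdegE big1 // => i _; apply/eqP; apply: contrapT => /negP/ui.
have um : mpoly.lem (mnm1 i) u by rewrite lep1mP.
have [|a am ak] := IHk (mnm_sub u (mnm1 i)).
  by have := congr1 (@mdeg n) (submK um); rewrite mdegD mdeg1 uk; lia.
exists (fun j => if unlift ord0 j is Some l then a l else cmon 1 (mnm1 i)).
  move=> j; case: unliftP => [l _|_] //.
  by apply/maxpsE; rewrite -(mdeg1 i); apply: ordge_cmon.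
rewrite big_ord_recl unlift_none -(submK um) addmC cmonD ak; congr (_ * _).
by apply: eq_bigr => j _; rewrite liftK.
Qed.

(** Every monomial of degree at least [k] is assigned one divisor of degree [k]; grouping the terms
    by this divisor writes [f] as a finite combination of monomials of degree [k]. *)
Lemma ordge_ideal_exp k : ordge k `<=` ideal_exp (@maxps n K) k.
Proof.
move=> f kf.
have /choice[dv Hdv] : forall m, exists u, (k <= mdeg m)%N -> mpoly.lem u m /\ mdeg u = k.
  move=> m; have [km|mk] := leqP k (mdeg m); last by exists m.
  by have [u um uk] := exists_divisor_mdeg km; exists u.
pose g u : A := PowSer (fun m => if dv (mnm_add u m) == u then coefps f (mnm_add u m) else 0).
have [_ _ M] := ideal_gen_ideal
  [set \prod_(i < k) a i | a in [set a : 'I_k -> A | forall i, maxps (a i)]].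
have -> : f = \sum_(u : bmultinom n k.+1 | mdeg (bmnm u) == k) cmon 1 (bmnm u) * g (bmnm u).
  apply: powserP => m; rewrite coefps_sum.
  have [mk|km] := ltnP (mdeg m) k.
    rewrite kf // big1 // => u /eqP uk; rewrite coefps_cmonM.
    case: ifP => // um; move: mk; rewrite -(submK um) mdegD uk; lia.
  have [um uk] := Hdv m km.
  have uk' : (mdeg (dv m) < k.+1)%N by rewrite uk.
  rewrite (bigD1 (BMultinom uk')); last by rewrite /= uk.
  rewrite coefps_cmonM um mul1r [coefps (g _) _]/= [mnm_add (dv m) _]addmC submK // eqxx.
  rewrite big1 => [|u /andP[_ ne]]; first by rewrite /= addr0.
  rewrite coefps_cmonM.
  case: ifP => // u'm; rewrite /= [mnm_add (bmnm u) _]addmC submK //.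
  case: eqP => [e|]; last by rewrite mulr0.
  by case/eqP: ne; apply/val_inj.
apply: ideal_sum; first exact: ideal_gen_ideal.
move=> u /eqP uk; rewrite mulrC; apply: M; apply: sub_ideal_gen.
by have [a am ->] := cmon_prod uk; exists a.
Qed.

Lemma lead_cmon m : is_lead (cmon (1 : K) m) m.
Proof.
split=> [|m' m'm] /=; first by rewrite eqxx oner_neq0.
by case: eqP m'm => // ->; rewrite ltxx.
Qed.

(** Along a strict chain of ideals containing m^(k+1) each step loses a standard monomial of degree
    at most [k], by [lead_mon_inj]. The default length 0 also satisfies the bound. *)
Lemma quot_length_hilb J k : ideal J ->
  (quot_length (ideal_add J (ideal_exp (@maxps n K) k.+1)) <= hilb J k)%N.
Proof.
move=> iJ; rewrite /quot_length; case: xgetP => [l _ [[c [cP cS]] _]|//].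
have iM := ideal_gen_ideal
  [set \prod_(i < k.+1) a i | a in [set a : 'I_k.+1 -> A | forall i, maxps (a i)]].
have step i : (i < l)%N -> (hilb (c i.+1) k < hilb (c i) k)%N.
  move=> il; have [ci Jc] := cP i (ltnW il); have [ci1 _] := cP i.+1 il.
  have [sub nsub] := cS i il.
  rewrite ltn_neqAle hilb_sub // andbT; apply/eqP => e; apply: nsub.
  have eS : std_set k (c i.+1) = std_set k (c i).
    apply/eqP; rewrite eqEcard -/(hilb (c i) k) -/(hilb (c i.+1) k) e leqnn andbT.
    apply/fintype.subsetP => m /mem_std_set nm; apply/mem_std_set => -[f cf fm].
    by apply: nm; exists f => //; apply: sub.
  apply: lead_mon_inj => // m lm.
  have [km|mk] := ltnP k (mdeg m).
    exists (cmon 1 m); last exact: lead_cmon.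
    apply: Jc; apply: ideal_addr => //; apply: ordge_ideal_exp.
    exact: ordgeW km (@ordge_cmon _ _ _ _).
  apply: contrapT => nlm.
  have : BMultinom (mk : (mdeg m < k.+1)%N) \in std_set k (c i) by apply/mem_std_set.
  by rewrite -eS => /mem_std_set; apply.
have [c0 Jc0] := cP 0%N (leq0n _).
have le i : (i <= l)%N -> (i + hilb (c i) k <= hilb (c 0%N) k)%N.
  elim: i => [//|i IHi] il; apply: leq_trans (IHi (ltnW il)).
  by rewrite addSnnS leq_add2l step.
apply: leq_trans (hilb_sub _ _ : (hilb (c 0%N) k <= _)%N).
  exact: leq_trans (leq_addr _ _) (le l (leqnn l)).
by apply: subset_trans Jc0; apply: ideal_addl.
Qed.

(** Locality of A: a series with nonzero constant term has leading monomial 1, so every monomial is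
    leading for [J] and [lead_mon_inj] gives the whole ring. *)
Lemma proper_sub_max J : ideal J -> ~ J 1 -> J `<=` @maxps n K.
Proof.
move=> iJ J1 f Jf; apply: contrapT => f0; apply: J1.
have iT : ideal [set: A] by [].
apply: (lead_mon_inj iJ iT) => // m _; apply: (@lead_mon_le _ _ _ mnm0) => //.
  by apply/mnm_lepP => i; rewrite mnm0E.
exists f => //; split; first exact/eqP.
by move=> m'; rewrite ltNge le0m.
Qed.

Lemma hilb_unit J k : ideal J -> J 1 -> hilb J k = 0%N.
Proof.
move=> [_ _ JM] J1; apply/eqP; rewrite cards_eq0; apply/eqP/setP => m.
rewrite finset.in_set0; apply/negP => /mem_std_set; apply.
by exists (cmon 1 (bmnm m)); [rewrite -[cmon _ _]mulr1; apply: JM|exact: lead_cmon].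
Qed.

Lemma maxps_prime : prime_ideal (@maxps n K).
Proof.
split; first exact: maxps_ideal.
  by move/eqP; rewrite /= eqxx oner_eq0.
move=> a b /eqP; rewrite coefpsM0 mulf_eq0 => /orP[/eqP|/eqP]; [left|right] => //.
Qed.

End MaximalIdeal.

Section Dimension.
Variables (n : nat) (K : fieldType).
Local Notation mon := (multinom n).
Local Notation A := (powser n K).
Implicit Types (f g : A) (m u : mon) (J L E P : set A) (k d : nat).

(** An ideal maximal among those of large growth is prime: if ab lies in P but neither factor does,
    then P + (a) and P : a are strictly larger, hence small, and [hilb_colon] makes P small. *)
Lemma prime_maximal d J : ideal J -> ~ small d (hilb J) ->
  exists P, [/\ prime_ideal P, J `<=` P & ~ small d (hilb P)].
Proof.
move=> iJ ns.
have [|P [iP [JP nsP] maxP]] :=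
    @ideal_maximal n K (fun P => J `<=` P /\ ~ small d (hilb P)).
  by exists J => //; split.
exists P; split=> //; split=> // [P1|a b Pab].
  by apply: nsP; exists 0%N => k; rewrite hilb_unit.
have bigger L : ideal L -> P `<=` L -> ~ (L `<=` P) -> small d (hilb L).
  move=> iL PL nLP; apply: contrapT => nsL; apply: nLP; apply: maxP => //.
  by split=> //; apply: subset_trans JP PL.
apply: contrapT => /not_orP[nPa nPb]; apply: nsP.
pose La := ideal_add P (ideal_gen [set a]).
pose Lb := [set f | P (a * f)].
have ga : ideal_gen [set a] a by apply: sub_ideal_gen.
have iLb : ideal Lb.
  case: (iP) => P0 PD PM; split; rewrite /Lb /=.
  - by rewrite mulr0.
  - by move=> f g Pf Pg; rewrite mulrDr; apply: PD.
  - by move=> f g Pg; rewrite mulrCA; apply: PM.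
have sa : small d (hilb La).
  apply: bigger; first by apply: ideal_add_ideal => //; apply: ideal_gen_ideal.
    by apply: ideal_addl; apply: ideal_gen_ideal.
  by move=> /(_ a) H; apply: nPa; apply: H; apply: ideal_addr.
have sb : small d (hilb Lb).
  apply: bigger => //; first by move=> f Pf; case: (iP) => _ _; apply.
  by move=> /(_ b) H; apply: nPb; apply: H.
apply: small_le (small_add sa sb) => k.
rewrite (hilb_colon k a iP) leq_add2l; apply: hilb_sub => f Pf.
by exists 0 => //; rewrite addr0.
Qed.

(** At level k + 1 the truncated colon by [x] contains [J] and m^(k+1), so its contribution is at
    most [hilb J k]; at level 0 it is the unit ideal. Then [small_step] applies. *)
Lemma small_section d J x : ideal J -> maxps x ->
  small d (hilb (section_ideal J x)) -> small d.+1 (hilb J).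
Proof.
move=> iJ mx; apply: small_step.
  rewrite (hilb_colon 0 x iJ) [X in (_ + X)%N]hilb_unit ?addn0 //.
    exact: colon_ideal.
  exists (- x); last by rewrite mulr1 subrr; case: iJ.
  by rewrite -sub0r; apply: ordgeB => //; apply/maxpsE.
move=> k; rewrite (hilb_colon k.+1 x iJ) leq_add2l; apply: hilb_le => m mk nlm.
split; last first.
  move=> [f Jf fm]; apply: nlm; exists f => //; exists 0 => //.
  by rewrite addr0; case: iJ => _ _; apply.
rewrite leqNgt; apply/negP => km; apply: nlm; exists (cmon 1 m); last exact: lead_cmon.
exists (- (x * cmon 1 m)); last by rewrite subrr; case: iJ.
rewrite -sub0r; apply: ordgeB => //; rewrite -[k.+2]add1n; apply: ordgeM.
  exact/maxpsE.
exact: ordgeW km (@ordge_cmon _ _ _ _).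
Qed.

Lemma has_chainS P (C D : set (set A)) d :
  C P -> D `<=` C -> (forall Q, D Q -> P `<` Q) -> has_chain D d -> has_chain C d.+1.
Proof.
move=> CP DC PD [c [cD cS]]; exists (fun i => if i is j.+1 then c j else P).
split=> [[//|i] il|[_|i il]]; [exact/DC/cD|exact/PD/cD|exact: cS].
Qed.

(** A prime P of the same growth starts the chain. Cutting by an element of the maximal ideal
    outside P lowers the growth by at most one degree and forces later primes to be strictly
    larger. *)
Lemma dim_ge_of_growth d J : ideal J -> ~ small d (hilb J) -> dim_ge J d.
Proof.
elim: d J => [|d IHd] J iJ ns.
  exists (fun=> @maxps n K); split=> [_ _|//]; split; first exact: maxps_prime.
  apply: proper_sub_max => // J1; apply: ns; exists 0%N => k.
  by rewrite hilb_unit.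
have [P [pP JP nsP]] := prime_maximal iJ ns; have [iP P1 _] := pP.
have [x mx Px] : exists2 x, maxps x & ~ P x.
  (* If P contained the maximal ideal, at most the monomial 1 would be standard; [hilb set0 0] is
     the count of that one monomial. *)
  apply: contrapT => nx; apply: nsP; exists (hilb (set0 : set A) 0) => k.
  apply: leq_mul; last by rewrite expnS leq_pmulr ?expn_gt0.
  apply: hilb_le => m mk nlm; split; last by case.
  rewrite leqNgt; apply/negP => m0; apply: nlm; exists (cmon 1 m); last exact: lead_cmon.
  apply: contrapT => nPm; apply: nx; exists (cmon 1 m) => //.
  exact: mdeg_gt0_max m0 (lead_cmon _ _).
pose L := section_ideal P x.
have iL : ideal L by apply: ideal_add_ideal => //; apply: ideal_gen_ideal.
have PL : P `<=` L by apply: ideal_addl; apply: ideal_gen_ideal.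
have nsL : ~ small d (hilb L) by move=> /(small_section iP mx).
apply: (has_chainS (P := P)) (IHd L iL nsL).
- by split.
- by move=> Q [pQ LQ]; split=> //; apply: subset_trans JP (subset_trans PL LQ).
- move=> Q [pQ LQ]; split; first exact: subset_trans PL LQ.
  move=> QP; apply/Px/QP/LQ; apply: ideal_addr => //.
  exact: sub_ideal_gen.
Qed.

(** With x in c 1 outside c 0, the quotient by c 0 + (x) grows at least like that by c 1. By
    Artin-Rees and primality, each element of the truncated colon agrees with an element of c 0 up
    to high order, so the colon term is at least a shifted copy of [hilb (c 0)]. *)
Lemma growth_of_dim_ge d J : dim_ge J d -> ~ small d (hilb J).
Proof.
elim: d J => [|d IHd] J [c [cC cS]].
  have [[ic c1 _] Jc] := cC 0%N (leqnn _).
  suff ns : ~ small 0 (hilb (c 0%N)).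
    by move=> sJ; apply: ns; apply: small_le sJ => k; apply: hilb_sub.
  apply: free_not_small => k; exists finset.set0; first by rewrite cards0.
  move=> m m0 mk [f cf fm].
  have em : m = mnm0 by apply/mnmP => i; rewrite m0 ?finset.in_set0 // mnm0E.
  have := proper_sub_max ic c1 cf; case: fm => /eqP + _; rewrite em.
  by move=> + f0; apply.
have [[ic0 c01 c0P] Jc0] := cC 0%N (leq0n _).
have [[ic1 c11 c1P] Jc1] := cC 1%N (ltn0Sn _).
have [sub01 nsub01] := cS 0%N (ltn0Sn _).
have {}IHd : ~ small d (hilb (c 1%N)).
  apply: IHd; exists (fun i => c i.+1); split=> i il; last exact: cS.
  have [pc _] := cC i.+1 il; split=> //.
  elim: i il {pc} => [|i IHi] il; first exact: subset_refl.
  apply: subset_trans (IHi (ltnW il)) _.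
  by have [] := cS i.+1 il.
have [x c1x c0x] : exists2 x, c 1%N x & ~ c 0%N x.
  apply: contrapT => nx; apply: nsub01 => x c1x.
  by apply: contrapT => c0x; apply: nx; exists x.
suff ns : ~ small d.+1 (hilb (c 0%N)).
  by move=> sJ; apply: ns; apply: small_le sJ => k; apply: hilb_sub.
pose L := ideal_add (c 0%N) (ideal_gen [set x]).
have iL : ideal L by apply: ideal_add_ideal => //; apply: ideal_gen_ideal.
have [s [F [e [LF HF]]]] := artin_rees iL.
(* The shift [e.+1] is positive, as [growth_step] requires. *)
apply: (@growth_step d e.+1 _ (hilb (c 1%N))) => // [k q qk|k ek].
  have [T Td fT] := small_or_free ic1 IHd k.
  by move: qk; rewrite -Td; apply: free_hilb.
rewrite (hilb_colon k x ic0); apply: leq_add.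
  apply: hilb_sub; apply: ideal_add_sub => //.
  by apply: ideal_gen_sub => // _ ->.
apply: hilb_le => m mk nlm; split; first by lia.
move=> [f [w kw c0f] fm].
have Lw : L w.
  rewrite -[w](addKr (x * f)) addrC; apply: idealB => //.
    exact: (ideal_addl (ideal_gen_ideal _)).
  apply: ideal_addr => //; rewrite mulrC; have [_ _] := ideal_gen_ideal [set x]; apply.
  exact: sub_ideal_gen.
have [b [bk wE]] := HF _ _ Lw kw.
have /choice[y Hy] : forall i, exists y, c 0%N (F i - y * x).
  move=> i; have [p cp [q]] := LF i; rewrite ideal_gen1E => -[y _ <-] <-.
  by exists y; rewrite addrK.
pose a := \sum_i b i * y i.
have ak : ordge (k.+1 - e) a.
  by apply: ordge_sum => i _; rewrite mulrC; apply: ordgeMl.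
(* The error [w] is rewritten as x times [a] modulo c 0, where [a] has order at least [k.+1 - e] and
   so does not disturb the leading monomial [m]. *)
have /c0P[//|c0fa] : c 0%N (x * (f + a)).
  have -> : x * (f + a) = (x * f + w) - \sum_i b i * (F i - y i * x).
    rewrite mulrDr wE -addrA; congr (_ + _); rewrite -sumrB /a mulr_sumr.
    apply: eq_bigr => i _; rewrite mulrBr opprB addrC subrK.
    by rewrite mulrC mulrA.
  apply: idealB => //; apply: ideal_sum => // i _.
  by case: ic0 => _ _; apply.
apply: nlm; exists (f + a) => //; have [fm0 fl] := fm; split.
  by rewrite coefpsD ak ?addr0 //; lia.
move=> m' m'm; rewrite coefpsD fl // add0r ak //.
by have := lemc_mdeg (ltW m'm); lia.
Qed.

(* The equality dim A/(J + (h)) = dim A/J - 1, without presupposing finite dimension. *)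
Lemma dim_ge_section J h l : prime_ideal J -> maxps h -> ~ J h ->
  dim_ge (section_ideal J h) l <-> dim_ge J l.+1.
Proof.
move=> pJ mh Jh; have [iJ J1 JP] := pJ.
have ig := ideal_gen_ideal [set h].
have iS : ideal (section_ideal J h) by apply: ideal_add_ideal.
split=> [|/growth_of_dim_ge ns].
  apply: (has_chainS (P := J)); first by split.
    by move=> Q [pQ SQ]; split=> //; apply: subset_trans SQ; apply: ideal_addl.
  move=> Q [pQ SQ]; split; first by apply: subset_trans SQ; apply: ideal_addl.
  by move=> QJ; apply/Jh/QJ/SQ; apply: ideal_addr => //; apply: sub_ideal_gen.
by apply: dim_ge_of_growth => // /(small_section iJ mh).
Qed.

End Dimension.

(** * Jacobian minors *)

Section Determinants.
Variable A : comNzRingType.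
Implicit Types (Q : set A).

Lemma ideal_prodB Q (T : Type) (s : seq T) (x y : T -> A) : ideal Q ->
  (forall i, Q (x i - y i)) -> Q (\prod_(i <- s) x i - \prod_(i <- s) y i).
Proof.
move=> [Q0 QD QM] Qxy; elim/big_rec2: _ => [|i u v _ Quv]; first by rewrite subrr.
have -> : x i * v - y i * u = v * (x i - y i) + y i * (v - u).
  by rewrite !mulrBr [v * x i]mulrC [v * y i]mulrC addrA subrK.
by apply: QD; apply: QM.
Qed.

Lemma ideal_detB Q r (M N : 'M[A]_r) : ideal Q ->
  (forall i j, Q (M i j - N i j)) -> Q (\det M - \det N).
Proof.
move=> iQ QMN; rewrite /determinant -sumrB; apply: ideal_sum => // s _.
by rewrite -mulrBr; case: (iQ) => _ _; apply; apply: ideal_prodB.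
Qed.

(** Multilinearity in the rows: Cauchy-Binet before equal or permuted row selections are
    collected. *)
Lemma det_mulmx_expand (r : nat) (X : finType) (a : 'I_r -> X -> A) (p : X -> 'I_r -> A) :
  \det (\matrix_(i, j) \sum_x a i x * p x j) =
  \sum_(phi : {ffun 'I_r -> X}) (\prod_i a i (phi i)) * \det (\matrix_(i, j) p (phi i) j).
Proof.
rewrite /determinant; under eq_bigr => s _.
  under eq_bigr do rewrite mxE.
  rewrite bigA_distr_bigA mulr_sumr; over.
rewrite exchange_big; apply: eq_bigr => phi _; rewrite mulr_sumr.
apply: eq_bigr => s _; rewrite big_split /= mulrCA; congr (_ * (_ * _)).
by apply: eq_bigr => i _; rewrite mxE.
Qed.

Lemma sort_perm (r k : nat) (s : 'I_r -> 'I_k) : injective s ->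
  exists p : {perm 'I_r}, forall i j : 'I_r, (i < j)%N -> (s (p i) < s (p j))%N.
Proof.
move=> s_inj; pose le (a b : 'I_k) := (a <= b)%N.
have le_tot : total le by move=> a b; apply: leq_total.
have le_tr : transitive le by move=> a b c; apply: leq_trans.
pose t := [tuple s i | i < r]; pose t' := sort_tuple le t.
have /tuple_permP[p tp] : perm_eq t' t by rewrite perm_sort.
exists p => i j ij.
have E l : s (p l) = nth (s l) t' l.
  by rewrite tp nth_mktuple tnth_mktuple.
have st : sorted le t' by apply: sort_sorted.
have : (s (p i) <= s (p j))%N.
  rewrite !E (set_nth_default (s i)) ?size_tuple //.
  have := sorted_leq_nth le_tr (fun a => leqnn a) (s i) st.
  by move=> /(_ i j); rewrite !inE size_tuple !ltn_ord => /(_ isT isT (ltnW ij)).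
rewrite leq_eqVlt => /predU1P[/val_inj/s_inj/perm_inj e|//].
by move: ij; rewrite e ltnn.
Qed.

End Determinants.

Section SingularIdeal.
Variables (n : nat) (K : comNzRingType).
Local Notation A := (powser n K).
Implicit Types (Y Q : set A).

(** A repeated row or column gives 0; any other selection is a permutation of an increasing one. *)
Lemma ideal_all_minors Q (r p q : nat) (M : 'M[A]_(p, q)) : ideal Q ->
  minors r M `<=` Q -> forall (s : 'I_r -> 'I_p) (t : 'I_r -> 'I_q), Q (\det (mxsub s t M)).
Proof.
move=> iQ minQ s t.
have [|/injectivePn[i [j ij e]]] := boolP (injectiveb s); last first.
  rewrite (determinant_alternate ij); first by case: iQ.
  by move=> c; rewrite !mxE e.
move=> /injectiveP s_inj.
have [|/injectivePn[i [j ij e]]] := boolP (injectiveb t); last first.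
  rewrite -det_tr (determinant_alternate ij); first by case: iQ.
  by move=> c; rewrite !mxE e.
move=> /injectiveP t_inj.
have [u su] := sort_perm s_inj; have [v tv] := sort_perm t_inj.
have -> : mxsub s t M = row_perm u^-1%g (col_perm v^-1%g (mxsub (s \o u) (t \o v) M)).
  by apply/matrixP => i j; rewrite !mxE /= !permKV.
case: (iQ) => _ _ QM; rewrite row_permE col_permE !det_mulmx.
apply: (QM); rewrite mulrC; apply: QM; apply: minQ.
by exists (s \o u), (t \o v); split.
Qed.

Lemma pderivpsM j (f g : A) : pderivps j (f * g) = pderivps j f * g + f * pderivps j g.
Proof.
(* The coefficient of a derivative at [m] reads degree [mdeg m + 1], so truncating below
   [mdeg m + 2] transports the polynomial Leibniz rule. *)
apply: powserP => m; pose d := (mdeg m).+2.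
have md : (mdeg m < d)%N by rewrite ltnW.
have mjd : (mdeg (mnm_add m (mnm1 j)) < d)%N by rewrite mdegD mdeg1 addn1.
have E (h : A) k : (mdeg k <= mdeg m)%N ->
    mcoeff k (mderiv j (trunc_ps d h)) = mcoeff k (trunc_ps d (pderivps j h)).
  move=> km; rewrite mcoeff_deriv !coef_trunc_ps //; first exact: leq_ltn_trans md.
  by rewrite mdegD mdeg1 addn1 ltnS ltnS.
transitivity (coefps (powser_mul f g) (mnm_add m (mnm1 j)) *+ (m j).+1); first by [].
rewrite (coef_mul_ps _ _ mjd) -mcoeff_deriv.
rewrite mderivM mcoeffD.
transitivity (mcoeff m (trunc_ps d (pderivps j f) * trunc_ps d g) +
              mcoeff m (trunc_ps d f * trunc_ps d (pderivps j g))).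
  by congr (_ + _); apply: mcoeffM_eq => // k km; rewrite E.
by rewrite -!coef_mul_ps.
Qed.

Lemma pderivps_sum j (T : Type) (s : seq T) (F : T -> A) :
  pderivps j (\sum_(i <- s) F i) = \sum_(i <- s) pderivps j (F i).
Proof.
elim/big_rec2: _ => [|i x y _ <-]; apply: powserP => m /=; first by rewrite mul0rn.
by rewrite mulrnDl.
Qed.

Definition jac_det r (g : 'I_r -> A) (t : 'I_r -> 'I_n) : A :=
  \det (\matrix_(i, j) pderivps (t j) (g i)).

(* By the Leibniz rule the derivatives of g i are, modulo the ideal of f, the
   combinations of those of f with the same coefficients. *)
Lemma jac_det_ideal (X : finType) (f : X -> A) Q r (g : 'I_r -> A) (t : 'I_r -> 'I_n) :
  ideal Q -> (forall x, Q (f x)) -> (forall phi : 'I_r -> X, Q (jac_det (f \o phi) t)) ->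
  (forall i, ideal_gen (range f) (g i)) -> Q (jac_det g t).
Proof.
move=> iQ Qf Qdet gY; have [Q0 QD QM] := iQ.
have /choice[a Ha] : forall i, exists a : X -> A, \sum_x a x * f x = g i.
  by move=> i; have := gY i; rewrite ideal_gen_span => -[a _ <-]; exists a.
pose N : 'M[A]_r := \matrix_(i, j) \sum_x a i x * pderivps (t j) (f x).
rewrite -[jac_det g t](subrK (\det N)); apply: QD.
  apply: ideal_detB => // i j; rewrite !mxE -Ha pderivps_sum -sumrB.
  apply: ideal_sum => // x _; rewrite pderivpsM addrK.
  by apply: QM.
rewrite (det_mulmx_expand a (fun x j => pderivps (t j) (f x))).
by apply: ideal_sum => // phi _; apply: QM; apply: (Qdet phi).
Qed.

(** All row and column selections are allowed, which gives a finite index type independent of the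
    values of [f]. *)
Definition sing_gen (X : finType) (f : X -> A) r
    (x : X + {ffun 'I_r -> X} * {ffun 'I_r -> 'I_n}) : A :=
  match x with
  | inl x => f x
  | inr (phi, t) => jac_det (f \o phi) t
  end.

End SingularIdeal.

(** The choice in [sing_ideal_at] is inhabited by Noetherianity; whichever generators it returns,
    [jac_det_ideal] applied in both directions shows that the ideal is the same. *)
Lemma sing_ideal_atE (n : nat) (K : fieldType) (X : finType) (f : X -> powser n K)
    (alpha : nat) (Y : set (powser n K)) : Y = ideal_gen (range f) ->
  sing_ideal_at alpha Y = ideal_gen (range (sing_gen f (r := (n - alpha)))).
Proof.
move=> YE; have iY : ideal Y by rewrite YE; apply: ideal_gen_ideal.
rewrite /sing_ideal_at; case: xgetP => [S _ [k [f0 [YE0 ->]]]|nS]; last first.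
  have [k [f0 YE0]] := ideal_fg iY.
  by case: (nS (ideal_add Y (ideal_gen (minors (n - alpha) (jacobian f0))))); exists k, f0.
set r := (n - alpha)%N.
have iR := ideal_gen_ideal (range (sing_gen f (r := r))).
have iM := ideal_gen_ideal (minors r (jacobian f0)).
have iL := ideal_add_ideal iY iM.
apply/seteqP; split.
  have YR : Y `<=` ideal_gen (range (sing_gen f (r := r))).
    rewrite YE; apply: ideal_gen_sub => // _ [x _ <-].
    by apply: sub_ideal_gen; exists (inl x).
  apply: ideal_add_sub => //; apply: ideal_gen_sub => // _ [s [t [_ _ ->]]].
  have -> : \det (mxsub s t (jacobian f0)) = jac_det (f0 \o s) t.
    by congr (\det _); apply/matrixP => i j; rewrite !mxE.
  apply: (jac_det_ideal iR (f := f)) => [x|phi|i].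
  - by apply: sub_ideal_gen; exists (inl x).
  - have -> : jac_det (f \o phi) t = jac_det (f \o [ffun i => phi i]) [ffun j => t j].
      by congr (\det _); apply/matrixP => i j; rewrite !mxE /= !ffunE.
    by apply: sub_ideal_gen; exists (inr ([ffun i => phi i], [ffun j => t j])).
  - by rewrite -YE YE0; apply: sub_ideal_gen; exists (s i).
apply: ideal_gen_sub => // _ [[x|[phi t]] _ <-] /=.
  by apply: ideal_addl => //; rewrite YE; apply: sub_ideal_gen; exists x.
apply: (jac_det_ideal iL (f := f0)) => [i|psi|i].
- by apply: ideal_addl => //; rewrite YE0; apply: sub_ideal_gen; exists i.
- have -> : jac_det (f0 \o psi) t = \det (mxsub psi t (jacobian f0)).
    by congr (\det _); apply/matrixP => i j; rewrite !mxE.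
  apply: ideal_addr => //; apply: ideal_all_minors => //; exact: sub_ideal_gen.
- by rewrite -YE0 YE; apply: sub_ideal_gen; exists (phi i).
Qed.

Lemma section_ideal_gen (n : nat) (K : fieldType) (X : finType) (f : X -> powser n K) h :
  section_ideal (ideal_gen (range f)) h = ideal_gen (range (oapp f h)).
Proof.
have ig := ideal_gen_ideal (range (oapp f h)).
apply/seteqP; split.
  apply: ideal_add_sub => //; apply: ideal_gen_sub => //.
    by move=> _ [x _ <-]; apply: sub_ideal_gen; exists (Some x).
  by move=> _ ->; apply: sub_ideal_gen; exists None.
apply: ideal_gen_sub.
  by apply: ideal_add_ideal; apply: ideal_gen_ideal.
move=> _ [[x|] _ <-] /=.
  by apply: ideal_addl; [exact: ideal_gen_ideal|apply: sub_ideal_gen; exists x].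
by apply: ideal_addr; [exact: ideal_gen_ideal|apply: sub_ideal_gen].
Qed.

(** * Definability of the singular scheme *)

(** An ideal maximal among those above [I] containing no power of [a] is prime. *)
Lemma radical_prime (n : nat) (K : fieldType) (I : set (powser n K)) a :
  ideal I -> reduced_subscheme I -> ~ I a ->
  exists P, [/\ prime_ideal P, I `<=` P & ~ P a].
Proof.
move=> iI rI Ia.
have [|P [iP [IP Pa] maxP]] :=
    @ideal_maximal n K (fun P => I `<=` P /\ forall k, ~ P (a ^+ k)).
  by exists I => //; split=> // k /rI.
exists P; split=> //; last by have := Pa 1%N; rewrite expr1.
split=> //; first by have := Pa 0%N; rewrite expr0.
have bigger u : ~ P u -> exists k, ideal_add P (ideal_gen [set u]) (a ^+ k).
  move=> Pu; apply: contrapT => /forallNP nk; apply: Pu.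
  have ig := ideal_gen_ideal [set u].
  apply: (maxP (ideal_add P (ideal_gen [set u]))).
  - exact: ideal_add_ideal.
  - by split=> //; apply: subset_trans IP _; apply: ideal_addl.
  - exact: ideal_addl.
  - by apply: ideal_addr => //; apply: sub_ideal_gen.
move=> u v Puv; apply: contrapT => /not_orP[/bigger[k] + /bigger[l]].
rewrite !ideal_gen1E => -[p Pp [_ [b _ <-] pE]] [q Pq [_ [c _ <-] qE]].
apply: (Pa (k + l)%N); rewrite exprD -pE -qE.
case: (iP) => _ PD PM; rewrite mulrDl; apply: (PD).
  by rewrite mulrC; apply: PM.
rewrite mulrDr; apply: PD; first exact: PM.
by rewrite mulrACA; apply: PM.
Qed.

(** If ab lies in I, then V(I) is covered by V(a) and V(b), hence lies in one of them; radicality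
    turns this back into membership. *)
Lemma prime_of_irreducible (n : nat) (K : fieldType) (I : set (powser n K)) :
  ideal I -> reduced_subscheme I -> irreducible_subscheme I -> prime_ideal I.
Proof.
move=> iI rI [[P0 [[iP0 P01 _] IP0]] irr]; split=> // [/IP0//|a b Iab].
have sub u : zero_locus I `<=` zero_locus (ideal_gen [set u]) -> I u.
  move=> Hu; apply: contrapT => /(radical_prime iI rI)[P [pP IP Pu]]; apply: Pu.
  by have [//|_] := Hu P; apply; apply: sub_ideal_gen.
have [|/sub|/sub] := irr _ _ (ideal_gen_ideal [set a]) (ideal_gen_ideal [set b]);
  [|by left|by right].
move=> P [pP IP]; have [iP _ PP] := pP.
by have [Pa|Pb] := PP a b (IP _ Iab); [left|right]; split=> //;
  apply: ideal_gen_sub => // _ ->.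
Qed.

Section DefinableSeries.
Variables (n : nat) (K : closedFieldType).
Local Notation A := (powser n K).

Definition polyps (F : (nat -> K) -> A) : Prop := forall m, polyfun (fun s => coefps (F s) m).

Lemma polyps_const f : polyps (fun=> f).
Proof. by move=> m; apply: polyfun_const. Qed.

Lemma polypsM F G : polyps F -> polyps G -> polyps (fun s => F s * G s).
Proof.
move=> pF pG m.
by apply: polyfun_sum => k _; apply: polyfunM; [apply: pF|apply: pG].
Qed.

Lemma polyps_sum (J : Type) (r : seq J) F :
  (forall j, polyps (F j)) -> polyps (fun s => \sum_(j <- r) F j s).
Proof.
move=> pF m; have := @polyfun_sum K J r xpredT (fun j s => coefps (F j s) m) (fun j _ => pF j m).
by congr polyfun; apply/funext => s; rewrite coefps_sum.
Qed.

Lemma polyps_prod (J : Type) (r : seq J) F :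
  (forall j, polyps (F j)) -> polyps (fun s => \prod_(j <- r) F j s).
Proof.
move=> pF; elim: r => [|j r IHr].
  by have := polyps_const 1; congr polyps; apply/funext => s; rewrite big_nil.
have := polypsM (pF j) IHr.
by congr polyps; apply/funext => s; rewrite big_cons.
Qed.

Lemma polyps_deriv j F : polyps F -> polyps (fun s => pderivps j (F s)).
Proof.
move=> pF m; have := polyfunM (pF (mnm_add m (mnm1 j))) (polyfun_const (m j).+1%:R).
by congr polyfun; apply/funext => s; rewrite mulr_natr.
Qed.

Lemma polyps_jac_det r (g : (nat -> K) -> 'I_r -> A) t :
  (forall i, polyps (fun s => g s i)) -> polyps (fun s => jac_det (g s) t).
Proof.
move=> pg; apply: polyps_sum => u; apply: polypsM; first exact: polyps_const.
apply: polyps_prod => i; have := polyps_deriv (t (u i)) (pg i).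
by congr polyps; apply/funext => s; rewrite mxE.
Qed.

Lemma polyps_sing_gen (X : finType) (f : (nat -> K) -> X -> A) r x :
  (forall x, polyps (fun s => f s x)) -> polyps (fun s => sing_gen (f s) (r := r) x).
Proof. by move=> pf; case: x => [x|[phi t]] //=; apply: polyps_jac_det => i; apply: pf. Qed.

(** Since the order compares degrees first, only finitely many monomials precede [m]. *)
Lemma definable_lead F m : polyps F -> definable (fun s => is_lead (F s) m).
Proof.
move=> pF; pose r := [seq m' <- map (@bmnm _ _) (enum {: bmultinom n (mdeg m).+1}) | (m' < m)%O].
apply: (@definable_ext K (fun s => ~ (coefps (F s) m = 0) /\
    forall m', m' \in r -> coefps (F s) m' = 0)).
  move=> s; split=> -[fm fl]; split; try exact/eqP.
    move=> m' m'm; apply: fl; rewrite mem_filter m'm /=.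
    have m'k : (mdeg m' < (mdeg m).+1)%N by rewrite ltnS; apply/lemc_mdeg/ltW.
    by apply/mapP; exists (BMultinom m'k) => //; rewrite mem_enum.
  by move=> m'; rewrite mem_filter => /andP[/fl].
apply: definable_and; first exact/definable_not/definable_eq0/pF.
by apply: definable_all => m' _; apply/definable_eq0/pF.
Qed.

(* An assignment carries the coefficients of h at even places, and those of an
   auxiliary family a at odd places. *)
Definition even_series (s : nat -> K) : A := PowSer (fun m => s (pickle m).*2).

Definition odd_series (G : countType) (s : nat -> K) (x : G) : A :=
  PowSer (fun m => s (pickle (x, m)).*2.+1).

Definition encode (G : countType) (h : A) (a : G -> A) (i : nat) : K :=
  if odd i then oapp (fun xm : G * multinom n => coefps (a xm.1) xm.2) 0 (unpickle i./2)
  else oapp (coefps h) 0 (unpickle i./2).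

Lemma even_encode (G : countType) h (a : G -> A) : even_series (encode h a) = h.
Proof. by apply: powserP => m; rewrite /= /encode odd_double doubleK pickleK. Qed.

Lemma odd_encode (G : countType) h (a : G -> A) x : odd_series (encode h a) x = a x.
Proof.
apply: powserP => m; rewrite /= /encode /= odd_double uphalf_double pickleK //.
Qed.

(** The unknown multipliers of the generators occupy the odd coordinates, which are quantified away
    while the even ones, holding h, stay fixed. *)
Lemma definable_lead_mon (G : finType) (F : A -> G -> A) m :
  (forall x, polyps (fun s => F (even_series s) x)) ->
  definable (fun s => lead_mon (ideal_gen (range (F (even_series s)))) m).
Proof.
move=> pF.
apply: (@definable_ext K (fun s => exists s', (forall v, ~~ odd v -> s' v = s v) /\
    is_lead (\sum_x odd_series s' x * F (even_series s') x) m)); last first.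
  apply: definable_exists; apply: definable_lead; apply: polyps_sum => x.
  by apply: polypsM => // m'; apply: polyfun_var.
have evE s s' : (forall v, ~~ odd v -> s' v = s v) -> even_series s' = even_series s.
  by move=> ss'; apply: powserP => m' /=; rewrite ss' ?odd_double.
move=> s; rewrite ideal_gen_span; split=> [[s' [/evE -> lm]]|[_ [a _ <-] lm]].
  by exists (\sum_x odd_series s' x * F (even_series s) x) => //; exists (odd_series s').
exists (fun v => if odd v then encode 0 a v else s v).
have ss' v : ~~ odd v -> (if odd v then encode 0 a v else s v) = s v by move/negPf->.
split=> //; rewrite (evE _ _ ss'); congr is_lead: lm; apply: eq_bigr => x _.
congr (_ * _); rewrite -[LHS](odd_encode 0 a); apply: powserP => m' /=.
by rewrite odd_double.
Qed.

Lemma definable_free (G : finType) (F : A -> G -> A) (T : {set 'I_n}) k :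
  (forall x, polyps (fun s => F (even_series s) x)) ->
  definable (fun s => free_on T k (ideal_gen (range (F (even_series s))))).
Proof.
move=> pF; pose r := [seq m : multinom n <- map (@bmnm _ _) (enum {: bmultinom n k.+1}) |
  [forall i : 'I_n, (i \notin T) ==> (m i == 0%N)]].
apply: (@definable_ext K (fun s => forall m, m \in r ->
    ~ lead_mon (ideal_gen (range (F (even_series s)))) m)).
  move=> s; split=> H m.
    move=> mT mk; apply: H; rewrite mem_filter; apply/andP; split.
      by apply/forallP => i; apply/implyP => /mT ->.
    by apply/mapP; exists (BMultinom (mk : (mdeg m < k.+1)%N)) => //; rewrite mem_enum.
  rewrite mem_filter => /andP[/forallP mT /mapP[m' _ mE]]; apply: H.
    by move=> i iT; have /implyP/(_ iT)/eqP := mT i.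
  by rewrite mE -ltnS bmdeg.
by apply: definable_all => m _; apply/definable_not/definable_lead_mon.
Qed.

End DefinableSeries.

(** * Series of order one, the multiplicity bound, and the compactness argument *)

Section OrderOne.
Variables (n : nat) (K : fieldType).

Lemma order1P (h : powser n K) : (@maxps n K `\` ideal_exp (@maxps n K) 2) h <->
  maxps h /\ exists i, coefps h (mnm1 i) <> 0.
Proof.
split=> -[mh h2]; split=> //.
  apply: contrapT => /forallNP hi; apply: h2; apply: ordge_ideal_exp => m m2.
  have [|m1] := eqVneq (mdeg m) 0%N; first by move/eqP; rewrite mdeg_eq0 => /eqP ->.
  have /mdeg1P[i /eqP ->] : mdeg m == 1%N by lia.
  by apply: contrapT; apply: hi.
case: h2 => i hi /ideal_exp_ordge h2; apply: hi; apply: h2.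
by rewrite mdeg1.
Qed.

Lemma krull_dim_eq (J L : set (powser n K)) :
  (forall l, dim_ge J l <-> dim_ge L l) -> krull_dim J = krull_dim L.
Proof.
move=> JL; rewrite /krull_dim; congr xget; apply/funext => d; apply/propext.
split=> -[dJ ndJ]; split; [exact/JL|move=> /JL//|exact/JL|move=> /JL//].
Qed.

Lemma dim_eqE (J : set (powser n K)) d : dim_eq J d -> krull_dim J = d.
Proof.
have down l l' : (l <= l')%N -> dim_ge J l' -> dim_ge J l.
  move=> ll' [c [cC cS]]; exists c; split=> i il; [apply: cC|apply: cS].
    exact: leq_trans il ll'.
  exact: leq_trans il ll'.
move=> dJ; rewrite /krull_dim; case: xgetP => [e _ eJ|/(_ d)//].
have [ed|] := ltnP e d; first by case: eJ => _ []; apply: down dJ.1.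
rewrite leq_eqVlt => /predU1P[//|de]; by case: dJ => _ []; apply: down eJ.1.
Qed.

End OrderOne.

(** A divergent sequence has the default limit 0, whence the condition [0 <= B]. *)
Lemma limn_le (R : realType) (u : nat -> R) (B : R) : 0 <= B ->
  (forall k, (0 < k)%N -> u k <= B) -> limn u <= B.
Proof.
move=> B0 uB; have [cu|ncu] := pselect (cvgn u); last by rewrite (dvgP ncu).
apply: limr_le => //; exists 1%N => // k; exact: uB.
Qed.

(** The factor [2 ^ d] comes from [N.+1 <= 2 * N]: the counting bound involves powers of [N.+1], the
    multiplicity divides by powers of [N]. *)
Lemma multiplicity_le (R : realType) (n : nat) (K : fieldType) (J : set (powser n K)) d k :
  ideal J -> dim_eq J d -> (forall T : {set 'I_n}, #|T| = d.+1 -> ~ free_on T k J) ->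
  multiplicity R (@maxps n K) J <= (d`! * (k.+1 ^ n * 2 ^ d))%:R.
Proof.
move=> iJ dJ nfree; apply: limn_le => [|N N0]; first exact: ler0n.
rewrite (dim_eqE dJ) ler_pdivrMr ?exprn_gt0 ?ltr0n //.
rewrite -natrX -!natrM ler_nat -mulnA leq_mul2l -mulnA -expnMn.
apply/orP; right; apply: leq_trans (quot_length_hilb _ iJ) _.
have := hilb_not_free N iJ nfree; rewrite expnSr mulnA leq_mul2r /= => /leq_trans; apply.
by rewrite leq_mul2l leq_wexp2r ?orbT //; lia.
Qed.

Theorem corollary3p14 (R : realType) (n : nat) (K : closedFieldType)
    (K_uncountable : ~ countable [set: K])
    (I : set (powser n K))
    (I_ideal : ideal I)
    (X_reduced : reduced_subscheme I)
    (X_irreducible : irreducible_subscheme I)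
    (X_nonembedded : forall h : powser n K,
       (@maxps n K `\` ideal_exp (@maxps n K) 2) h ->
       ~ (ideal_gen [set h] `<=` I))
    (h_ : nat -> powser n K)
    (h_order1 : forall i, (@maxps n K `\` ideal_exp (@maxps n K) 2) (h_ i))
    (d : nat)
    (sing_dim : forall i, dim_eq (sing_ideal (section_ideal I (h_ i))) d)
    (sing_mult :
       (fun i => multiplicity R (@maxps n K)
                   (sing_ideal (section_ideal I (h_ i)))) @ \oo --> +oo) :
  exists h : powser n K,
    (@maxps n K `\` ideal_exp (@maxps n K) 2) h /\
    dim_ge (sing_ideal (section_ideal I h)) d.+1.
Proof.
have pI := prime_of_irreducible I_ideal X_reduced X_irreducible.
have [p [f IE]] := ideal_fg I_ideal.
have dimS h : (@maxps n K `\` ideal_exp (@maxps n K) 2) h ->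
    forall l, dim_ge (section_ideal I h) l <-> dim_ge I l.+1.
  move=> h1 l; apply: dim_ge_section => //; first by case: h1.
  by move=> Ih; apply: (X_nonembedded h h1); apply: ideal_gen_sub => // _ ->.
(* The minor size is fixed on the first section, so that [G] is a type chosen before h; [dimS] makes
   it correct for every admissible h. *)
pose r := (n - krull_dim (section_ideal I (h_ 0%N)))%N.
pose G := (option 'I_p + {ffun 'I_r -> option 'I_p} * {ffun 'I_r -> 'I_n})%type.
pose F (h : powser n K) : G -> powser n K := sing_gen (oapp f h) (r := r).
have singE h : (@maxps n K `\` ideal_exp (@maxps n K) 2) h ->
    sing_ideal (section_ideal I h) = ideal_gen (range (F h)).
  move=> h1; rewrite /sing_ideal (krull_dim_eq (L := section_ideal I (h_ 0%N))).
    by apply: sing_ideal_atE; rewrite IE section_ideal_gen.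
  by move=> l; rewrite !dimS.
(* The order-one condition is part of each [P k], so that the limit solution again defines a smooth
   hypersurface. *)
pose P k s := (maxps (even_series n s) /\
    exists2 i : 'I_n, i \in enum 'I_n & coefps (even_series n s) (mnm1 i) <> 0) /\
  exists2 T : {set 'I_n}, T \in [seq T : {set 'I_n} <- enum {: {set 'I_n}} | #|T| == d.+1]
    & free_on T k (ideal_gen (range (F (even_series n s)))).
have [|k s|k|s Ps] := @definable_saturation K P K_uncountable.
- move=> k; apply: definable_and; last first.
    apply: definable_has => T _; apply: definable_free => x.
    apply: polyps_sing_gen => -[i|]; first exact: polyps_const.
    by move=> m; apply: polyfun_var.
  apply: definable_and; first by apply: definable_eq0; apply: polyfun_var.
  apply: definable_has => i _; apply: definable_not; apply: definable_eq0.
  exact: polyfun_var.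
- move=> [h1 [T TP fT]]; split=> //; exists T => // m mT mk; apply: fT => //.
  exact: leqW.
- have [i [T Td fT]] : exists i, exists2 T : {set 'I_n}, #|T| = d.+1
      & free_on T k (sing_ideal (section_ideal I (h_ i))).
    apply: contrapT => nT.
    have /cvgryPgt/(_ (d`! * (k.+1 ^ n * 2 ^ d))%:R)[N _ /(_ N (leqnn N))] := sing_mult.
    apply/negP; rewrite -leNgt; apply: multiplicity_le (sing_dim N) _ => [|T Td fT].
      by rewrite singE //; apply: ideal_gen_ideal.
    by apply: nT; exists N, T.
  have [hm [j hj]] := (order1P (h_ i)).1 (h_order1 i).
  (* The odd coordinates are irrelevant to [P k] and are filled with zeros. *)
  exists (encode (h_ i) (fun _ : unit => 0)); rewrite /P even_encode; split.
    by split=> //; exists j => //; rewrite mem_enum.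
  exists T; last by rewrite -singE.
  by rewrite mem_filter Td eqxx mem_enum.
have h1 : (@maxps n K `\` ideal_exp (@maxps n K) 2) (even_series n s).
  by apply/order1P; have [[hm [i _ hi]] _] := Ps 0%N; split=> //; exists i.
exists (even_series n s); split=> //; rewrite singE //.
apply: dim_ge_of_growth; first exact: ideal_gen_ideal.
apply: free_not_small => k; have [_ [T]] := Ps k.
by rewrite mem_filter => /andP[/eqP Td _] fT; exists T.
Qed.
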